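(* Let $G$ be a (simple) graph with maximum degree $\Delta\leq 4$. Then $\kappa_E(G,\Delta+2)=1$, i.e., any two $(\Delta+2)$-edge-colourings of $G$ are Kempe equivalent.
   Context: A $k$-edge-colouring of a graph $G$ is an assignment of colours from $\{1,\ldots,k\}$ to the edges of $G$ such that adjacent edges (edges sharing an endpoint) receive different colours. Given a $k$-edge-colouring and two colours $a,b$, the edges coloured $a$ or $b$ form a subgraph whose components are paths and cycles alternating in $a$ and $b$; a Kempe change is the operation of interchanging $a$ and $b$ on one such connected component (a maximal $(a,b)$-alternating path or an $(a,b)$-alternating cycle), which yields another $k$-edge-colouring. Two $k$-edge-colourings are Kempe equivalent if one can be obtained from the other by a sequence of Kempe changes; colourings differing only by a permutation of the colours are regarded as the same colouring. $\kappa_E(G,k)$ denotes the number of Kempe equivalence classes of $k$-edge-colourings of $G$. *)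

(* Defs.v *)
From HB Require Import structures.
From mathcomp Require Import all_boot all_fingroup.
Set Implicit Arguments. Unset Strict Implicit. Unset Printing Implicit Defensive.

Record sgraph := SGraph {
  vertex :> finType;
  adj : rel vertex;
  adj_sym : symmetric adj;
  adj_irrefl : irreflexive adj
}.

Definition degree (G : sgraph) (x : G) : nat := #|[set y | adj x y]|.

Definition max_degree (G : sgraph) : nat := \max_(x : G) degree x.

Definition edges (G : sgraph) : {set {set G}} :=
  [set [set x; y] | x in [set: G], y in [set: G] & adj x y].

Definition edge (G : sgraph) : finType := {f : {set G} | f \in edges G}.

Definition edge_adj (G : sgraph) : rel (edge G) :=
  fun f g => (f != g) && (val f :&: val g != set0).

Definition proper_colouring (G : sgraph) (k : nat)
    (c : {ffun edge G -> 'I_k}) : bool :=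
  [forall f, forall g, edge_adj f g ==> (c f != c g)].

Definition colouring (G : sgraph) (k : nat) : finType :=
  {c : {ffun edge G -> 'I_k} | proper_colouring c}.

Definition bicoloured_adj (G : sgraph) (k : nat)
    (c : {ffun edge G -> 'I_k}) (a b : 'I_k) : rel (edge G) :=
  fun f g => [&& edge_adj f g, c f \in [set a; b] & c g \in [set a; b]].

(* [a] and [b] interchanged on the component containing [f] of the subgraph
   formed by the edges coloured [a] or [b]; only meaningful when [f] itself has
   one of these colours. Components are represented by their edge sets. *)
Definition kempe_change (G : sgraph) (k : nat) (c : {ffun edge G -> 'I_k})
    (a b : 'I_k) (f : edge G) : {ffun edge G -> 'I_k} :=
  [ffun g => if connect (bicoloured_adj c a b) f g
             then tperm a b (c g) else c g].

Definition kempe_step (G : sgraph) (k : nat) : rel (colouring G k) :=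
  fun c d => [exists a : 'I_k, exists b : 'I_k, exists f : edge G,
    [&& a != b, val c f \in [set a; b]
      & val d == kempe_change (val c) a b f]].

Definition colour_perm (G : sgraph) (k : nat) : rel (colouring G k) :=
  fun c d => [exists s : {perm 'I_k}, val d == [ffun f => s (val c f)]].

(* Colourings that differ by a permutation of the colours are identified, so
   the equivalence is generated by Kempe changes and colour permutations. *)
Definition kempe_equiv (G : sgraph) (k : nat) : rel (colouring G k) :=
  connect (fun c d => kempe_step c d || colour_perm c d).

Definition kappa_E (G : sgraph) (k : nat) : nat :=
  #|equivalence_partition (@kempe_equiv G k) [set: colouring G k]|.

Lemma edge_adj_sym (G : sgraph) : symmetric (@edge_adj G).
Proof. by move=> f g; rewrite /edge_adj eq_sym setIC. Qed.

Lemma tperm_in (T : finType) (a b x : T) :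
  (tperm a b x \in [set a; b]) = (x \in [set a; b]).
Proof. by rewrite !inE; case: tpermP => [->|->|//]; rewrite !eqxx ?orbT. Qed.

Lemma kempe_change_in (G : sgraph) (k : nat) (c : {ffun edge G -> 'I_k})
    (a b : 'I_k) (f g : edge G) :
  (kempe_change c a b f g \in [set a; b]) = (c g \in [set a; b]).
Proof. by rewrite ffunE; case: ifP; rewrite ?tperm_in. Qed.

Lemma kempe_changeK (G : sgraph) (k : nat) (c : {ffun edge G -> 'I_k})
    (a b : 'I_k) (f : edge G) :
  kempe_change (kempe_change c a b f) a b f = c.
Proof.
apply/ffunP=> g; rewrite ffunE.
have -> : connect (bicoloured_adj (kempe_change c a b f) a b) f g
        = connect (bicoloured_adj c a b) f g.
  by apply: eq_connect => x y; rewrite /bicoloured_adj !kempe_change_in.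
by rewrite ffunE; case: (connect _ f g); rewrite ?tpermK.
Qed.

Lemma kempe_change_proper (G : sgraph) (k : nat) (c : {ffun edge G -> 'I_k})
    (a b : 'I_k) (f : edge G) :
  c f \in [set a; b] -> proper_colouring c ->
  proper_colouring (kempe_change c a b f).
Proof.
move=> cf pc; apply/forallP=> g; apply/forallP=> h; apply/implyP=> gh.
have cgh : c g != c h by move/forallP/(_ g)/forallP/(_ h)/implyP: pc; apply.
have [cg|cg] := boolP (c g \in [set a; b]); last first.
  have [ch|ch] := boolP (c h \in [set a; b]).
    apply: contraNneq cg => E.
    by rewrite -(kempe_change_in c a b f g) E kempe_change_in.
  have nab x : c x \notin [set a; b] -> tperm a b (c x) = c x.
    by rewrite !inE negb_or ![c x == _]eq_sym => /andP[? ?]; rewrite tpermD.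
  by rewrite !ffunE !nab // !if_same.
have [ch|ch] := boolP (c h \in [set a; b]); last first.
  apply: contraNneq ch => E.
  by rewrite -(kempe_change_in c a b f h) -E kempe_change_in.
have bgh : bicoloured_adj c a b g h by rewrite /bicoloured_adj gh cg ch.
have bhg : bicoloured_adj c a b h g.
  by rewrite /bicoloured_adj edge_adj_sym gh cg ch.
have E : connect (bicoloured_adj c a b) f g = connect (bicoloured_adj c a b) f h.
  by apply/idP/idP => H; apply: connect_trans H _; apply: connect1.
by rewrite !ffunE E; case: ifP => // _; rewrite (inj_eq perm_inj).
Qed.

Lemma kempe_step_sym (G : sgraph) (k : nat) : symmetric (@kempe_step G k).
Proof.
apply: symmetric_from_pre => c d /existsP[a /existsP[b /existsP[f]]].
case/and3P=> ab cf /eqP E; apply/existsP; exists a; apply/existsP; exists b.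
by apply/existsP; exists f; rewrite ab E kempe_change_in cf kempe_changeK eqxx.
Qed.

Lemma colour_perm_sym (G : sgraph) (k : nat) : symmetric (@colour_perm G k).
Proof.
apply: symmetric_from_pre => c d /existsP[s /eqP E].
by apply/existsP; exists s^-1%g; rewrite E; apply/eqP/ffunP=> f; rewrite !ffunE permK.
Qed.

Lemma kempe_equiv_equivalence (G : sgraph) (k : nat) :
  equivalence_rel (@kempe_equiv G k).
Proof.
apply/equivalence_relP; split=> [c|]; first exact: connect0.
have sym : symmetric (fun c d : colouring G k => kempe_step c d || colour_perm c d).
  by move=> c d; rewrite kempe_step_sym colour_perm_sym.
by move=> c d /(same_connect (sym_connect_sym sym)).
Qed.

(* Main.v *)
Require Import Defs.
From mathcomp Require Import all_boot all_fingroup.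
From Stdlib Require Import Classical.
Set Implicit Arguments. Unset Strict Implicit. Unset Printing Implicit Defensive.

(** Induction on the graph, deleting a vertex [v]. Each of the at most four
    neighbours of [v] has at least three free colours in a colouring [psi] of
    [G - v], so the extensions of [psi] to [G] are the systems of distinct
    representatives (SDRs) of the lists of free colours. There is one unless
    [psi] is stuck: [v] has four neighbours and they all have the same three
    free colours. Any two SDRs are joined by recolouring one edge or swapping
    two edges at [v], each a Kempe change. A Kempe change between two
    extendable colourings of [G - v] lifts to [G] along a suitable SDR. A stuck
    colouring is left by exchanging a free colour [a] with a non-free one [b] on
    a component that contains some, but not all, of the neighbours of [v]; it
    exists because a path has only two ends. Exits on disjoint pairs of colours
    commute with each other and with any other Kempe change on different
    colours, and there are enough colours to choose a disjoint pair, so a walk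
    through stuck colourings can be replaced by one through extendable ones. *)

(** * Counting in small finite sets *)

Lemma card3_third (T : finType) (A : {set T}) p q :
  3 <= #|A| -> exists t, [/\ t \in A, t != p & t != q].
Proof.
move=> A3; case: (pickP [pred t in A | (t != p) && (t != q)]) => [t|H].
  by case/andP=> tA /andP[tp tq]; exists t.
suff /subset_leq_card : A \subset [set p; q].
  by rewrite cards2 => /(leq_trans A3); case: (p != q).
apply/subsetP=> t tA; move: (H t).
by rewrite /= tA /= !inE; case: (t == p); case: (t == q).
Qed.

Lemma card4_mem (T : finType) (N : {set T}) i j l m :
  #|N| <= 4 -> i \in N -> j \in N -> l \in N -> m \in N ->
  uniq [:: i; j; l; m] -> forall z, z \in N -> z \in [:: i; j; l; m].
Proof.
move=> N4 iN jN lN mN u z zN.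
have sub : {subset [:: i; j; l; m] <= enum N}.
  by move=> w; rewrite !inE mem_enum => /or4P[] /eqP->.
have := uniq_min_size u sub; rewrite -cardE => /(_ N4)[_ ->].
by rewrite mem_enum.
Qed.

(** * Reconfiguration of systems of distinct representatives *)

Section Sdr.
Variables (V T : finType) (N : {set V}) (L : V -> {set T}).

Definition sdr (x : V -> T) :=
  (forall i, i \in N -> x i \in L i) /\ {in N &, injective x}.

Definition upd (x : V -> T) i t := fun z => if z == i then t else x z.
Definition swp (x : V -> T) i j := upd (upd x i (x j)) j (x i).

(** [reconf_eq] absorbs values outside [N], where an assignment is arbitrary. The two moves are
    those that [reconf_keq] realises by Kempe changes at the deleted vertex. *)
Inductive reconf : (V -> T) -> (V -> T) -> Prop :=
| reconf_eq x y : {in N, x =1 y} -> reconf x y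
| reconf_upd x y i t : i \in N -> t \in L i ->
    (forall j, j \in N -> x j != t) -> reconf (upd x i t) y -> reconf x y
| reconf_swp x y i j : i \in N -> j \in N -> i != j ->
    x j \in L i -> x i \in L j -> reconf (swp x i j) y -> reconf x y.

Lemma sdr_upd x i t : sdr x -> i \in N -> t \in L i ->
  (forall j, j \in N -> x j != t) -> sdr (upd x i t).
Proof.
move=> [xL xI] iN tL fr; rewrite /upd; split=> [z zN|z w zN wN].
  by case: eqP => [->|_] //; apply: xL.
case: (z =P i) => [->|_]; case: (w =P i) => [->|_] // E.
- by case/eqP: (fr _ wN).
- by case/eqP: (fr _ zN).
- exact: xI.
Qed.

Lemma sdr_swp x i j : sdr x -> i \in N -> j \in N -> i != j ->
  x j \in L i -> x i \in L j -> sdr (swp x i j).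
Proof.
move=> [xL xI] iN jN ij xji xij; rewrite /swp /upd; split=> [z zN|z w zN wN].
  by case: eqP => [->//|_]; case: eqP => [->//|_]; apply: xL.
have I2 a b : a \in N -> b \in N -> x a = x b -> a = b by move=> *; apply: xI.
case: (z =P j) => [->|zj]; case: (w =P j) => [->|wj] //;
  try (case: (z =P i) => [zi|zi]); try (case: (w =P i) => [wi|wi]) => // E;
  by [exfalso; have := I2 _ _ _ _ E; intuition congruence
     | rewrite ?zi ?wi; have := I2 _ _ _ _ E; intuition congruence].
Qed.

Definition dis (x y : V -> T) := [set z in N | x z != y z].

Hypothesis N4 : #|N| <= 4.
Hypothesis L3 : forall i, i \in N -> 3 <= #|L i|.

(** Induction on the number of positions where [x] differs from the target [y]. The cases get
    harder, each assuming that the earlier ones fail. *)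
Section Step.
Variables x y : V -> T.
Hypotheses (sx : sdr x) (sy : sdr y).
Hypothesis IH : forall x', sdr x' -> #|dis x' y| < #|dis x y| -> reconf x' y.

Let D := dis x y.

Lemma disP z : reflect (z \in N /\ x z != y z) (z \in D).
Proof. by rewrite inE; apply: andP. Qed.

Lemma reconf_step_upd i : i \in D -> (forall j, j \in N -> x j != y i) ->
  reconf x y.
Proof.
case/disP=> iN xi fr; have yL := sy.1 _ iN.
apply: (reconf_upd iN yL fr); apply: IH; first exact: sdr_upd.
apply: proper_card; apply/properP; split.
  apply/subsetP=> z; rewrite !inE /upd; case: (z == i) / eqP => [->|//].
  by rewrite eqxx andbF.
by exists i; rewrite !inE ?iN // /upd !eqxx.
Qed.

(** The swap corrects [i], and [j] was already wrong because [y] is injective. *)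
Lemma reconf_step_swp i j : i \in D -> j \in N -> x j = y i -> x i \in L j ->
  reconf x y.
Proof.
move=> iD jN xj xij; have [iN xi] := disP _ iD.
have yL : x j \in L i by rewrite xj; apply: sy.1.
have ij : i != j by apply: contraNneq xi => {1}->; rewrite xj.
have yj : x j != y j.
  by apply: contraNneq ij; rewrite xj => /sy.2->.
apply: (reconf_swp iN jN ij yL xij); apply: IH; first exact: sdr_swp.
apply: proper_card; apply/properP; split.
  apply/subsetP=> z; rewrite !inE /swp /upd; case: (z =P j) => [->|_].
    by rewrite jN.
  by case: (z =P i) => [->|//]; rewrite xj eqxx andbF.
by exists i => //; rewrite !inE iN /swp /upd (negbTE ij) eqxx xj eqxx.
Qed.

Hypothesis used : forall i, i \in D -> exists2 j, j \in N & x j = y i.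

Lemma used_dis i j : i \in D -> j \in N -> x j = y i -> j \in D /\ i != j.
Proof.
move=> /disP[iN xi] jN xj.
have ij : i != j by apply: contraNneq xi => {1}->; rewrite xj.
split=> //; rewrite inE jN /=.
by apply: contraNneq ij; rewrite xj => /sy.2->.
Qed.

(** By [used], the values of [y] on [D] are values of [x] on [D]. Both maps are injective, so the
    two value sets coincide and matching values permutes [D]. *)
Lemma dis_pred i : i \in D -> exists2 j, j \in D & y j = x i.
Proof.
move=> iD; have sub : y @: D \subset x @: D.
  apply/subsetP=> _ /imsetP[z zD ->]; have [w wN E] := used zD.
  by rewrite -E; apply: imset_f; have [] := used_dis zD wN E.
have DN z : z \in D -> z \in N by case/disP.
have : y @: D == x @: D.
  rewrite eqEcard sub !card_in_imset ?leqnn // => z w /DN zN /DN wN.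
    exact: sy.2.
  exact: sx.2.
by move/eqP/setP/(_ (x i)); rewrite (imset_f x iD) => /imsetP[j jD ->]; exists j.
Qed.

(** Parking [i] at the fresh [t] releases [x i], the value that some [j] wants. Then [j] becomes
    right, while [i] was wrong before. *)
Lemma reconf_step_free i t : i \in D -> t \in L i ->
  (forall j, j \in N -> x j != t) -> reconf x y.
Proof.
move=> iD tL fr; have [iN xi] := disP _ iD.
have [j jD yj] := dis_pred iD; have [jN xj] := disP _ jD.
have ji : j != i by apply: contraNneq xi => {2}<-; rewrite yj.
have s1 := sdr_upd sx iN tL fr.
have yL := sy.1 _ jN.
have fr2 z : z \in N -> upd x i t z != y j.
  move=> zN; rewrite /upd yj; case: (z =P i) => [_|zi]; first by rewrite eq_sym fr.
  by apply: contra_not_neq zi => /sx.2->.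
apply: (reconf_upd iN tL fr); apply: (reconf_upd jN yL fr2).
apply: IH; first exact: sdr_upd.
apply: proper_card; apply/properP; split.
  apply/subsetP=> z; rewrite !inE /upd; case: (z =P j) => [->|_].
    by rewrite eqxx andbF.
  by case: (z =P i) => [->|//]; rewrite iN.
by exists j => //; rewrite !inE jN /upd !eqxx.
Qed.

(** What is left: no swap corrects a position, and every value available to a wrong position is in
    use. *)
Hypothesis clash : forall i j, i \in D -> j \in N -> x j = y i -> x i \notin L j.
Hypothesis full : forall i t, i \in D -> t \in L i -> exists2 j, j \in N & x j = t.

(** With three wrong positions, moves may spoil others as long as at most two errors remain at the
    end. *)
Lemma reconf_step_pair x' i j l a b : i \in D -> j \in D -> l \in D ->
  uniq [:: i; j; l] -> sdr x' ->
  (forall z, z \in N -> z != a -> z != b -> x' z = y z) -> reconf x' y.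
Proof.
move=> iD jD lD u sx' H; apply: IH => //.
apply: (@leq_ltn_trans 2).
  apply: (@leq_trans #|[set a; b]|); last by rewrite cards2; case: (a != b).
  apply: subset_leq_card; apply/subsetP=> z; rewrite !inE => /andP[zN].
  by apply: contraR; rewrite negb_or => /andP[za zb]; rewrite H.
rewrite cardE; apply: (@uniq_leq_size _ [:: i; j; l]) => // z.
by rewrite !inE mem_enum => /or3P[] /eqP->.
Qed.

Lemma third_value i p q : i \in D ->
  exists2 h, h \in N & [/\ x h \in L i, x h != p & x h != q].
Proof.
move=> iD; have [iN _] := disP _ iD.
have [t [tL tp tq]] := card3_third p q (L3 iN).
by have [h hN E] := full iD tL; exists h; rewrite ?E.
Qed.

(** [clash] keeps [x m] out of [L i] and [x j] out of [L l], so three values per list force [x l]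
    into [L i] and [x i] into [L l]. Swapping the opposite positions [i], [l] and then [i], [j]
    corrects [i] and [j]. *)
Lemma reconf_step_cycle4 i j l m : i \in D -> j \in D -> l \in D -> m \in D ->
  uniq [:: i; j; l; m] ->
  x j = y i -> x l = y j -> x m = y l -> x i = y m -> reconf x y.
Proof.
move=> iD jD lD mD u xj xl xm xi.
have [iN _] := disP _ iD; have [jN _] := disP _ jD.
have [lN _] := disP _ lD; have [mN _] := disP _ mD.
have N_ := card4_mem N4 iN jN lN mN u.
move: (u); rewrite /= !inE !negb_or => /andP[/and3P[ij il im] /andP[/andP[jl jm] /andP[lm _]]].
have xlLi : x l \in L i.
  have [h hN [hL hi hj]] := third_value (x i) (x j) iD.
  have := N_ h hN; rewrite !inE => /or4P[] /eqP E; subst h => //.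
  - by rewrite eqxx in hi.
  - by rewrite eqxx in hj.
  - by have := clash mD iN xi; rewrite hL.
have xiLl : x i \in L l.
  have [h hN [hL hi hj]] := third_value (x l) (x m) lD.
  have := N_ h hN; rewrite !inE => /or4P[] /eqP E; subst h => //.
  - by have := clash jD lN xl; rewrite hL.
  - by rewrite eqxx in hi.
  - by rewrite eqxx in hj.
apply: (reconf_swp iN lN il xlLi xiLl).
have s1 := sdr_swp sx iN lN il xlLi xiLl; set x1 := swp x i l in s1 *.
have e1i : x1 i = x l by rewrite /x1 /swp /upd (negbTE il) eqxx.
have e1l : x1 l = x i by rewrite /x1 /swp /upd eqxx.
have e1 z : z != i -> z != l -> x1 z = x z.
  by rewrite /x1 /swp /upd => /negbTE-> /negbTE->.
have e1j : x1 j = x j by rewrite e1 // eq_sym.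
have a1 : x1 j \in L i by rewrite e1j xj; apply: sy.1.
have a2 : x1 i \in L j by rewrite e1i xl; apply: sy.1.
apply: (reconf_swp iN jN ij a1 a2).
apply: (@reconf_step_pair _ i j l l m) => //.
- by rewrite /= !inE !negb_or ij il jl.
- exact: sdr_swp.
move=> z /N_; rewrite !inE => /or4P[] /eqP -> //; rewrite ?eqxx //.
- by rewrite /swp /upd eqxx (negbTE ij) e1j.
- by rewrite /swp /upd eqxx e1i.
Qed.

(* The three swaps turn the values (1, 2, 3; 4) at (i, j, l; m) into
   (2, 3, 4; 1) via (1, 4, 3; 2) and (2, 4, 3; 1). *)
Lemma reconf_step_via i j l m : i \in D -> j \in D -> l \in D -> m \in N ->
  uniq [:: i; j; l; m] -> x j = y i -> x l = y j -> x i = y l ->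
  x m \in L j -> x m \in L l -> x i \in L m -> x j \in L m -> reconf x y.
Proof.
move=> iD jD lD mN u xj xl xi mj ml im' jm'.
have [iN _] := disP _ iD; have [jN _] := disP _ jD; have [lN _] := disP _ lD.
have N_ := card4_mem N4 iN jN lN mN u.
move: (u); rewrite /= !inE !negb_or => /andP[/and3P[ij il im] /andP[/andP[jl jm] /andP[lm _]]].
apply: (reconf_swp jN mN jm mj jm').
have s1 := sdr_swp sx jN mN jm mj jm'; set x1 := swp x j m in s1 *.
have e1j : x1 j = x m by rewrite /x1 /swp /upd (negbTE jm) eqxx.
have e1m : x1 m = x j by rewrite /x1 /swp /upd eqxx.
have e1 z : z != j -> z != m -> x1 z = x z.
  by rewrite /x1 /swp /upd => /negbTE-> /negbTE->.
have e1i : x1 i = x i by rewrite e1.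
have e1l : x1 l = x l by rewrite e1 // eq_sym.
have a1 : x1 m \in L i by rewrite e1m xj; apply: sy.1.
have a2 : x1 i \in L m by rewrite e1i.
apply: (reconf_swp iN mN im a1 a2).
have s2 := sdr_swp s1 iN mN im a1 a2; set x2 := swp x1 i m in s2 *.
have e2i : x2 i = x j by rewrite /x2 /swp /upd (negbTE im) eqxx.
have e2j : x2 j = x m by rewrite /x2 /swp /upd (negbTE jm) eq_sym (negbTE ij).
have e2l : x2 l = x l by rewrite /x2 /swp /upd (negbTE lm) eq_sym (negbTE il).
have b1 : x2 l \in L j by rewrite e2l xl; apply: sy.1.
have b2 : x2 j \in L l by rewrite e2j.
apply: (reconf_swp jN lN jl b1 b2).
apply: (@reconf_step_pair _ i j l l m) => //.
- by rewrite /= !inE !negb_or ij il jl.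
- exact: sdr_swp.
move=> z /N_; rewrite !inE => /or4P[] /eqP -> //; rewrite ?eqxx //.
- by rewrite /swp /upd (negbTE il) (negbTE ij) e2i.
- by rewrite /swp /upd eqxx (negbTE jl) e2l.
Qed.

(** Each list on the cycle has a third value. As [clash] rules out the remaining value of the cycle,
    it is [x m] for the fourth position [m]. *)
Lemma reconf_step_cycle3 i j l : i \in D -> j \in D -> l \in D ->
  uniq [:: i; j; l] -> x j = y i -> x l = y j -> x i = y l -> reconf x y.
Proof.
move=> iD jD lD u xj xl xi.
have [iN _] := disP _ iD; have [jN _] := disP _ jD; have [lN _] := disP _ lD.
move: (u); rewrite /= !inE !negb_or => /andP[/andP[ij il] /andP[jl _]].
have [m mN [mi xmi xmj]] := third_value (x i) (x j) iD.
have ml : l != m.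
  by apply: contraTneq mi => <-; apply: clash xi.
have u4 : uniq [:: i; j; l; m].
  rewrite /= !inE !negb_or ij il jl ml /= andbT.
  by apply/andP; split; [apply: contraNneq xmi|apply: contraNneq xmj] => <-.
have N_ := card4_mem N4 iN jN lN mN u4.
have mj : x m \in L j.
  have [h hN [hL hi hj]] := third_value (x j) (x l) jD.
  have := N_ h hN; rewrite !inE => /or4P[] /eqP E; subst h => //.
  - by have := clash iD jN xj; rewrite hL.
  - by rewrite eqxx in hi.
  - by rewrite eqxx in hj.
have ml' : x m \in L l.
  have [h hN [hL hi hj]] := third_value (x l) (x i) lD.
  have := N_ h hN; rewrite !inE => /or4P[] /eqP E; subst h => //.
  - by rewrite eqxx in hj.
  - by have := clash jD lN xl; rewrite hL.
  - by rewrite eqxx in hi.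
(* If all of [L m] is in use, it contains at least two values of the cycle, and one of the three
   rotations of [reconf_step_via] applies. *)
have [m_full|] := boolP [forall t in L m, [exists h in N, x h == t]].
  have third p q : exists2 h, h \in N & [/\ x h \in L m, x h != p & x h != q].
    have [t [tL tp tq]] := card3_third p q (L3 mN).
    have /exists_inP[h hN /eqP E] := forall_inP m_full t tL.
    by exists h; rewrite ?E.
  have two a b c : [:: a; b; c] =i [:: i; j; l] -> x a \notin L m ->
    x b \in L m /\ x c \in L m.
    move=> E aL; have inb z : z \in N -> x z \in L m -> x z != x m ->
      (z == b) || (z == c).
      move=> zN zL zm; have := N_ z zN.
      have -> : (z \in [:: i; j; l; m]) = (z \in [:: i; j; l]) || (z == m).
        by rewrite !inE -!orbA.
      rewrite -E !inE -!orbA => /or4P[/eqP Ez|->|->|/eqP Ez] //; rewrite ?orbT //.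
        by rewrite -Ez zL in aL.
      by rewrite Ez eqxx in zm.
    have [h hN [hL hm hc]] := third (x m) (x c).
    have [h' hN' [hL' hm' hb']] := third (x m) (x b).
    split.
      by case/orP: (inb h hN hL hm) => /eqP Eh; rewrite -Eh // Eh eqxx in hc *.
    by case/orP: (inb h' hN' hL' hm') => /eqP Eh; rewrite -Eh // Eh eqxx in hb' *.
  move: u4; rewrite /= !inE !negb_or => /andP[/and3P[_ _ im] /andP[/andP[_ jm] /andP[lm _]]].
  have [iL|/(two i j l)[|jL lL]] // := boolP (x i \in L m); last first.
    apply: (@reconf_step_via j l i m) => //=.
    by rewrite !inE !negb_or jl jm lm im -!(eq_sym i) ij il.
  have [jL|/(two j i l)[z|_ lL]] := boolP (x j \in L m); last first.
  - apply: (@reconf_step_via l i j m) => //=.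
    by rewrite !inE !negb_or lm im ij jm -!(eq_sym _ l) jl il.
  - by rewrite !inE orbCA.
  apply: (@reconf_step_via i j l m) => //=.
  by rewrite !inE !negb_or ij il im jl jm lm.
rewrite negb_forall_in => /exists_inP[t tL]; rewrite negb_exists_in => /forall_inP fr.
apply: (reconf_upd mN tL fr).
move: u4; rewrite /= !inE !negb_or => /andP[/and3P[_ _ im] /andP[/andP[_ jm] /andP[lm _]]].
have s1 := sdr_upd sx mN tL fr; set x1 := upd x m t in s1 *.
have I z w : z \in N -> w \in N -> z != w -> x z != x w.
  by move=> zN wN; apply: contra_neq; apply: sx.2.
have E1 z : z != m -> x1 z = x z by rewrite /x1 /upd => /negbTE->.
have E1m : x1 m = t by rewrite /x1 /upd eqxx.
have f1 z : z \in N -> x1 z != x m.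
  move=> zN; have [->|zm] := eqVneq z m; first by rewrite E1m eq_sym fr.
  by rewrite E1 // I.
apply: (reconf_upd iN mi f1).
have s2 := sdr_upd s1 iN mi f1; set x2 := upd x1 i (x m) in s2 *.
have E2 z : z != i -> x2 z = x1 z by rewrite /x2 /upd => /negbTE->.
have E2i : x2 i = x m by rewrite /x2 /upd eqxx.
have yL z : z \in N -> y z \in L z by apply: sy.1.
have f2 z : z \in N -> x2 z != y l.
  move=> zN; have [->|zi] := eqVneq z i; first by rewrite E2i -xi I // eq_sym.
  rewrite E2 // -xi; have [->|zm] := eqVneq z m; first by rewrite E1m eq_sym fr.
  by rewrite E1 // I.
apply: (reconf_upd lN (yL l lN) f2).
have s3 := sdr_upd s2 lN (yL l lN) f2; set x3 := upd x2 l (y l) in s3 *.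
have E3 z : z != l -> x3 z = x2 z by rewrite /x3 /upd => /negbTE->.
have E3l : x3 l = y l by rewrite /x3 /upd eqxx.
have f3 z : z \in N -> x3 z != y j.
  move=> zN; have [->|zl] := eqVneq z l.
    by rewrite E3l -xi -xl I.
  rewrite E3 //; have [->|zi] := eqVneq z i; first by rewrite E2i -xl I // eq_sym.
  rewrite E2 // -xl; have [->|zm] := eqVneq z m; first by rewrite E1m eq_sym fr.
  by rewrite E1 // I.
apply: (reconf_upd jN (yL j jN) f3).
apply: (@reconf_step_pair _ i j l i m) => //; first exact: (sdr_upd s3 jN (yL j jN) f3).
move=> z /N_; rewrite !inE => /or4P[] /eqP -> //; rewrite ?eqxx // => _ _.
  by rewrite /upd eqxx.
by rewrite /upd eq_sym (negbTE jl) E3l.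
Qed.

(** Following wanted values from a wrong position traces a cycle. [clash] excludes length two, and
    [N] has no room for more than four. *)
Lemma reconf_step_cycles : D != set0 -> reconf x y.
Proof.
case/set0Pn=> i iD; have [iN _] := disP _ iD.
have [j jN xj] := used iD; have [jD ij] := used_dis iD jN xj.
have [l lN xl] := used jD; have [lD jl] := used_dis jD lN xl.
have yI a b : a \in N -> b \in N -> y a = y b -> a = b by move=> *; apply: sy.2.
have il : i != l.
  apply: contraTneq isT => E; have := clash iD jN xj.
  by rewrite E xl (sy.1 _ jN).
have [m mN xm] := used lD; have [mD lm] := used_dis lD mN xm.
have jm : j != m.
  by apply: contraNneq il => E; apply/eqP/yI => //; rewrite -xj -xm E.
have [E|mi] := eqVneq i m.
  by apply: (@reconf_step_cycle3 i j l); rewrite //= ?inE ?negb_or ?ij ?il ?jl ?E.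
have u : uniq [:: i; j; l; m] by rewrite /= !inE !negb_or ij il mi jl jm lm.
apply: (@reconf_step_cycle4 i j l m) => //.
have [h hN xh] := used mD; have [hD mh] := used_dis mD hN xh.
have := card4_mem N4 iN jN lN mN u hN; rewrite !inE.
case/or4P=> /eqP E; subst h => //.
- by case/eqP: mi; apply: yI => //; rewrite -xj.
- by case/eqP: jm; apply: yI => //; rewrite -xl.
- by rewrite eqxx in mh.
Qed.
End Step.

Theorem sdr_reconf x y : sdr x -> sdr y -> reconf x y.
Proof.
have [n] := ubnP #|dis x y|; elim: n x => // n IHn x lt_n sx sy.
have IH x' : sdr x' -> #|dis x' y| < #|dis x y| -> reconf x' y.
  by move=> sx' lt; apply: IHn => //; apply: leq_trans lt _.
have [D0|Dn0] := eqVneq (dis x y) set0.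
  apply: reconf_eq => z zN; apply/eqP.
  by apply: contraFT (in_set0 z) => xyz; rewrite -D0 inE zN.
have [/exists_inP[i iD /forall_inP fr]|] :=
    boolP [exists i in dis x y, [forall j in N, x j != y i]].
  exact: reconf_step_upd IH _ iD fr.
rewrite negb_exists_in => /forall_inP used.
have {}used i : i \in dis x y -> exists2 j, j \in N & x j = y i.
  move=> /used; rewrite negb_forall_in => /exists_inP[j jN]; rewrite negbK => /eqP E.
  by exists j.
have [/exists_inP[i iD /exists_inP[j jN /andP[/eqP xj xi]]]|] :=
    boolP [exists i in dis x y, [exists j in N, (x j == y i) && (x i \in L j)]].
  exact: reconf_step_swp IH _ _ iD jN xj xi.
rewrite negb_exists_in => /forall_inP clash.
have {}clash i j : i \in dis x y -> j \in N -> x j = y i -> x i \notin L j.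
  move=> /clash; rewrite negb_exists_in => /forall_inP H jN E.
  by have := H j jN; rewrite E eqxx.
have [/exists_inP[i iD /exists_inP[t tL /forall_inP fr]]|] :=
    boolP [exists i in dis x y, [exists t in L i, [forall j in N, x j != t]]].
  exact: reconf_step_free IH used _ _ iD tL fr.
rewrite negb_exists_in => /forall_inP full.
apply: reconf_step_cycles IH used clash _ Dn0 => //.
move=> i t /full; rewrite negb_exists_in => /forall_inP H /H.
rewrite negb_forall_in => /exists_inP[j jN]; rewrite negbK => /eqP E.
by exists j.
Qed.

End Sdr.

(** * Existence of systems of distinct representatives *)

Definition stuck (V T : finType) (N : {set V}) (L : V -> {set T}) :=
  #|N| = 4 /\ exists2 A : {set T}, #|A| = 3 & forall i, i \in N -> L i = A.

Lemma sdr_greedy (V T : finType) (t0 : T) (N : {set V}) (L : V -> {set T}) :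
  (forall i, i \in N -> #|N| <= #|L i|) -> exists x, sdr N L x.
Proof.
have [n] := ubnP #|N|; elim: n N => // n IHn N ltN HL.
have [->|/set0Pn[i iN]] := eqVneq N set0.
  by exists (fun=> t0); split=> [i|i j]; rewrite inE.
have cN := cardsD1 i N; rewrite iN add1n in cN.
have [|j /setD1P[_ jN]|x [xL xI]] := IHn (N :\ i).
- by rewrite cN in ltN.
- by apply: leq_trans (HL j jN); rewrite cN.
have [t tL tn] : exists2 t, t \in L i & t \notin x @: (N :\ i).
  apply/subsetPn; apply/negP => /subset_leq_card le.
  have := leq_trans (HL i iN) (leq_trans le (leq_imset_card _ _)).
  by rewrite cN ltnn.
have fr z : z \in N -> z != i -> x z != t.
  by move=> zN zi; apply: contraNneq tn => <-; apply: imset_f; rewrite !inE zi.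
exists (upd x i t); split=> [z zN|z w zN wN]; rewrite /upd.
  by case: (z =P i) => [->|/eqP zi] //; apply: xL; rewrite !inE zi.
case: (z =P i) => [->|/eqP zi]; case: (w =P i) => [->|/eqP wi] // E.
- by have := fr w wN wi; rewrite -E eqxx.
- by have := fr z zN zi; rewrite E eqxx.
- by apply: xI; rewrite ?inE ?zi ?wi.
Qed.

(** Three of four positions are served greedily. If the list of the last one, [m], is exhausted, it
    equals the set of the three used values. Any other position with a value outside that set can
    move there and release its own for [m]; if there is none, all lists agree. *)
Lemma sdr_or_stuck (V T : finType) (t0 : T) (N : {set V}) (L : V -> {set T}) :
  #|N| <= 4 -> (forall i, i \in N -> 3 <= #|L i|) ->
  (exists x, sdr N L x) \/ stuck N L.
Proof.
move=> N4 L3.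
have [N3|N3] := leqP #|N| 3.
  by left; apply: sdr_greedy => // i /L3; apply: leq_trans.
have cN : #|N| = 4 by apply/eqP; rewrite eqn_leq N4.
have /card_gt0P[m mN] : 0 < #|N| by rewrite cN.
have cNm := cardsD1 m N; rewrite mN cN add1n in cNm; case: cNm => cNm.
have [i /setD1P[_ iN]|x [xL xI]] := @sdr_greedy _ T t0 (N :\ m) L.
  by rewrite -cNm; apply: L3.
have cA : #|x @: (N :\ m)| = 3 by rewrite card_in_imset // -cNm.
have ext x' t : sdr (N :\ m) L x' -> t \in L m ->
    (forall z, z \in N -> z != m -> x' z != t) -> exists x, sdr N L x.
  move=> [x'L x'I] tL fr; exists (upd x' m t); split=> [z zN|z w zN wN]; rewrite /upd.
    by case: (z =P m) => [->|/eqP zm] //; apply: x'L; rewrite !inE zm.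
  case: (z =P m) => [->|/eqP zm]; case: (w =P m) => [->|/eqP wm] // E.
  - by have := fr w wN wm; rewrite -E eqxx.
  - by have := fr z zN zm; rewrite E eqxx.
  - by apply: x'I; rewrite ?inE ?zm ?wm.
have [Lm|/subsetPn[t tL tn]] := boolP (L m \subset x @: (N :\ m)); last first.
  left; apply: (ext x t) => // z zN zm.
  by apply: contraNneq tn => <-; apply: imset_f; rewrite !inE zm.
have eqA i : i \in N -> L i \subset x @: (N :\ m) -> L i = x @: (N :\ m).
  by move=> iN sub; apply/eqP; rewrite eqEcard sub cA L3.
have [H|] := boolP [forall i in N, L i \subset x @: (N :\ m)].
  right; split=> //; exists (x @: (N :\ m)) => // i iN.
  exact: eqA (forall_inP H i iN).
rewrite negb_forall_in => /exists_inP[i iN /subsetPn[t tL tn]]; left.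
have im : i != m by apply: contraNneq tn => E; rewrite -(eqA m) // -E.
have iNm : i \in N :\ m by rewrite !inE im.
have fr z : z \in N :\ m -> x z != t.
  by move=> zN; apply: contraNneq tn => <-; apply: imset_f.
apply: (ext (upd x i t) (x i)); first by apply: sdr_upd.
  by rewrite (eqA m) //; apply: imset_f.
move=> z zN zm; rewrite /upd; case: (z =P i) => [_|/eqP zi].
  by rewrite eq_sym fr.
by apply: contra_neq zi; apply: xI; rewrite ?inE ?zm ?im.
Qed.

(** * Representatives compatible with a flip *)

Section Good.
Variables (V T : finType) (N S : {set V}) (L : V -> {set T}).
Hypothesis N4 : #|N| <= 4.
Hypothesis L3 : forall i, i \in N -> 3 <= #|L i|.

Definition good a b (x : V -> T) := forall i j, i \in N -> j \in N ->
  i \in S -> j \notin S -> x i \in [set a; b] -> x j \in [set a; b] ->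
  [set a; b] \subset L i \/ [set a; b] \subset L j.

(** The free colours after the flip; see [free_flip]. *)
Definition flip_lists a b i : {set T} :=
  if i \in S then [set tperm a b t | t in L i] else L i.

Section Fixed.
Variables (a b : T) (x : V -> T) (i j : V).
Hypotheses (ab : a != b) (sx : sdr N L x) (iN : i \in N) (jN : j \in N).
Hypotheses (iS : i \in S) (jS : j \notin S) (xi : x i = a) (xj : x j = b).
Hypotheses (bLi : b \notin L i) (aLj : a \notin L j).
Hypothesis bad : forall x', sdr N L x' -> ~ good a b x'.

Lemma good_support x' p q : (forall z, z \in N -> x' z \in [set a; b] -> z = p \/ z = q) ->
  [\/ (p \in S) = (q \in S), [set a; b] \subset L p | [set a; b] \subset L q] ->
  good a b x'.
Proof.
move=> H E u w uN wN uS wS xu xw.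
case: (H u uN xu) => Eu; case: (H w wN xw) => Ew; subst u w.
- by rewrite uS in wS.
- by case: E => [E||]; [rewrite -E uS in wS | left | right].
- by case: E => [E||]; [rewrite E uS in wS | right | left].
- by rewrite uS in wS.
Qed.

Lemma x_ab z : z \in N -> x z \in [set a; b] -> z = i \/ z = j.
Proof.
move=> zN; rewrite !inE => /orP[] /eqP E; [left|right]; apply: sx.2 => //.
  by rewrite xi.
by rewrite xj.
Qed.

Lemma used_or_fresh t : (exists2 z, z \in N & x z = t) \/
  (forall z, z \in N -> x z != t).
Proof.
have [/exists_inP[z zN /eqP E]|] := boolP [exists z in N, x z == t].
  by left; exists z.
by rewrite negb_exists_in => /forall_inP; right.
Qed.

Lemma i_used t : t \in L i -> exists2 z, z \in N & x z = t.
Proof.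
move=> tL; case: (used_or_fresh t) => // fr; exfalso.
apply: (bad (sdr_upd sx iN tL fr)); apply: (@good_support _ j j); last exact: Or31.
move=> z zN; rewrite /upd; case: (z =P i) => [zi|zi].
  rewrite !inE => /orP[] /eqP E; first by have := fr i iN; rewrite E xi eqxx.
  by have := bLi; rewrite -E tL.
by case/x_ab=> // ->; right.
Qed.

Lemma j_used t : t \in L j -> exists2 z, z \in N & x z = t.
Proof.
move=> tL; case: (used_or_fresh t) => // fr; exfalso.
apply: (bad (sdr_upd sx jN tL fr)); apply: (@good_support _ i i); last exact: Or31.
move=> z zN; rewrite /upd; case: (z =P j) => [zj|zj].
  rewrite !inE => /orP[] /eqP E; last by have := fr j jN; rewrite E xj eqxx.
  by have := aLj; rewrite -E tL.
by case/x_ab=> // ->; left.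
Qed.

Let ij : i != j.
Proof. by apply: contraTneq iS => ->. Qed.

Lemma bad_other l m : l \in N -> m \in N -> uniq [:: i; j; l; m] ->
    x l \in L i -> x l \in L j ->
  (l \in S /\ L l \subset [set a; x l; x m]) \/
  (l \notin S /\ L l \subset [set b; x l; x m]).
Proof.
move=> lN mN u li lj.
have N_ := card4_mem N4 iN jN lN mN u.
move: u; rewrite /= !inE !negb_or => /andP[/and3P[_ il im] /andP[/andP[jl jm] /andP[lm _]]].
have I z w : z \in N -> w \in N -> z != w -> x z != x w.
  by move=> zN wN; apply: contra_neq; apply: sx.2.
have la : x l != a by rewrite -xi I // eq_sym.
have lb : x l != b by rewrite -xj I // eq_sym.
have lab : x l \notin [set a; b] by rewrite !inE negb_or la.
have l_used t : t \in L l -> t \in [set a; b; x l; x m].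
  move=> tL; case: (used_or_fresh t) => [[z /N_]|fr].
    by rewrite !inE => /or4P[] /eqP-> <-; rewrite ?xi ?xj ?eqxx ?orbT.
  exfalso; have s1 := sdr_upd sx lN tL fr.
  have fr1 z : z \in N -> upd x l t z != x l.
    by move=> zN; rewrite /upd; case: (z =P l) => [_|/eqP zl];
      [rewrite eq_sym fr | apply: I].
  apply: (bad (sdr_upd s1 iN li fr1)); apply: (@good_support _ j j); last exact: Or31.
  move=> z zN; rewrite /upd; case: (z =P i) => [_|zi].
    by rewrite (negbTE lab).
  case: (z =P l) => [_|zl]; last by case/x_ab=> // ->; right.
  rewrite !inE => /orP[] /eqP E.
    by have := fr i iN; rewrite E xi eqxx.
  by have := fr j jN; rewrite E xj eqxx.
have swap_i : a \in L l -> l \in S /\ b \notin L l.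
  move=> al; have il_ok : x i \in L l by rewrite xi.
  have s1 := sdr_swp sx iN lN il li il_ok.
  have sup z : z \in N -> swp x i l z \in [set a; b] -> z = l \/ z = j.
    move=> zN; rewrite /swp /upd; case: (z =P l) => [->|_]; first by left.
    case: (z =P i) => [_|zi]; first by rewrite (negbTE lab).
    by case/x_ab=> // ->; right.
  split.
    apply/negPn/negP => lS; apply: (bad s1); apply: good_support sup _.
    by apply: Or31; rewrite (negbTE lS) (negbTE jS).
  apply/negP => bl; apply: (bad s1); apply: good_support sup _.
  by apply: Or32; apply/subsetP=> z; rewrite !inE => /orP[] /eqP->.
have swap_j : b \in L l -> l \notin S.
  move=> bl; have jl_ok : x j \in L l by rewrite xj.
  have s1 := sdr_swp sx jN lN jl lj jl_ok; apply/negP=> lS.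
  apply: (bad s1); apply: (@good_support _ i l); last by apply: Or31; rewrite iS lS.
  move=> z zN; rewrite /swp /upd; case: (z =P l) => [->|_]; first by right.
  case: (z =P j) => [_|zj]; first by rewrite (negbTE lab).
  by case/x_ab=> // ->; left.
have [lS|lS] := boolP (l \in S); [left|right]; split=> //; apply/subsetP=> t tL.
  have := l_used t tL; rewrite !inE -!orbA => /or4P[] /eqP E; rewrite E ?eqxx ?orbT //.
  by rewrite E in tL; have := swap_j tL; rewrite lS.
have := l_used t tL; rewrite !inE -!orbA => /or4P[] /eqP E; rewrite E ?eqxx ?orbT //.
by rewrite E in tL; have [] := swap_i tL; rewrite (negbTE lS).
Qed.

(** All values in [L i] and [L j] are used, which yields the other positions [l], [m] and the lists
    [a], [x l], [x m] inside [S] and [b], [x l], [x m] outside. Exchanging [a] and [b] inside [S]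
    makes them all equal. *)
Lemma bad_stuck : stuck N (flip_lists a b).
Proof.
have third_i p q : exists2 h, h \in N & [/\ x h \in L i, x h != p & x h != q].
  have [t [tL tp tq]] := card3_third p q (L3 iN).
  by have [h hN E] := i_used tL; exists h; rewrite ?E.
have [l lN [li la _]] := third_i a a.
have [m mN [mi ma ml]] := third_i a (x l).
have lb : x l != b by apply: contraNneq bLi => <-.
have mb : x m != b by apply: contraNneq bLi => <-.
have u : uniq [:: i; j; l; m].
  rewrite /= !inE !negb_or ij /= andbT -!andbA; apply/and5P; split.
  - by apply: contraNneq la => <-; rewrite xi.
  - by apply: contraNneq ma => <-; rewrite xi.
  - by apply: contraNneq lb => <-; rewrite xj.
  - by apply: contraNneq mb => <-; rewrite xj.
  - by apply: contraNneq ml => ->.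
have N_ := card4_mem N4 iN jN lN mN u.
have c4 : #|N| = 4.
  apply/eqP; rewrite eqn_leq N4 cardE; apply: (uniq_leq_size u) => z.
  by rewrite !inE mem_enum => /or4P[] /eqP->.
have Lj p q : exists2 h, h \in N & [/\ x h \in L j, x h != p & x h != q].
  have [t [tL tp tq]] := card3_third p q (L3 jN).
  by have [h hN E] := j_used tL; exists h; rewrite ?E.
have lj : x l \in L j.
  have [h hN [hL h1 h2]] := Lj b (x m).
  have := N_ h hN; rewrite !inE => /or4P[] /eqP E; subst h => //.
  - by rewrite xi (negbTE aLj) in hL.
  - by rewrite xj eqxx in h1.
  - by rewrite eqxx in h2.
have mj : x m \in L j.
  have [h hN [hL h1 h2]] := Lj b (x l).
  have := N_ h hN; rewrite !inE => /or4P[] /eqP E; subst h => //.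
  - by rewrite xi (negbTE aLj) in hL.
  - by rewrite xj eqxx in h1.
  - by rewrite eqxx in h2.
have u' : uniq [:: i; j; m; l].
  by move: u; rewrite /= !inE !negb_or (eq_sym m) => /andP[/and3P[-> -> ->] /andP[/andP[-> ->] ->]].
have subB z : z \in N -> (z \in S /\ L z \subset [set a; x l; x m]) \/
    (z \notin S /\ L z \subset [set b; x l; x m]).
  move=> /[dup] zN /N_; rewrite !inE => /or4P[] /eqP E; subst z.
  - left; split=> //; apply/subsetP=> t tL; have [h hN E] := i_used tL.
    have := N_ h hN; rewrite -E !inE => /or4P[] /eqP Eh; subst h; rewrite ?xi ?eqxx ?orbT //.
    by rewrite -E xj (negbTE bLi) in tL.
  - right; split=> //; apply/subsetP=> t tL; have [h hN E] := j_used tL.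
    have := N_ h hN; rewrite -E !inE => /or4P[] /eqP Eh; subst h; rewrite ?xj ?eqxx ?orbT //.
    by rewrite -E xi (negbTE aLj) in tL.
  - exact: bad_other.
  - have := bad_other mN lN u' mi mj.
    by rewrite -!setUA ![[set x m] :|: _]setUC !setUA.
have cB : #|[set b; x l; x m]| = 3.
  by rewrite setUC cardsU1 cards2 !inE negb_or mb ml eq_sym lb.
split=> //; exists [set b; x l; x m] => // z zN; apply/eqP.
rewrite eqEcard cB /flip_lists; case: (subB z zN) => -[zS /subsetP sub].
  rewrite zS card_imset; last exact: perm_inj.
  rewrite L3 // andbT; apply/subsetP=> _ /imsetP[t tL ->].
  have := sub t tL; rewrite !inE -!orbA => /or3P[] /eqP->.
  - by rewrite tpermL eqxx.
  - by rewrite tpermD ?eqxx ?orbT // eq_sym.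
  - by rewrite tpermD ?eqxx ?orbT // eq_sym.
by rewrite (negbTE zS) L3 // andbT; apply/subsetP.
Qed.
End Fixed.

(** A failure puts one of [a], [b] at some [i] in [S] and the other at some [j] outside, neither
    list holding both. Up to exchanging the colours, this is the setting of [bad_stuck]. *)
Theorem good_sdr a b x : a != b -> sdr N L x ->
  ~ stuck N (flip_lists a b) -> exists2 x', sdr N L x' & good a b x'.
Proof.
move=> ab sx nstuck.
have goodC x' : good b a x' -> good a b x'.
  by move=> g; rewrite /good setUC; apply: g.
have flC : stuck N (flip_lists b a) -> stuck N (flip_lists a b).
  case=> c4 [A cA HA]; split=> //; exists A => // i iN; rewrite -(HA i iN).
  by rewrite /flip_lists; case: ifP => // _; rewrite tpermC.
have [//|none] := classic (exists2 x', sdr N L x' & good a b x').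
have bad x' : sdr N L x' -> ~ good a b x' by move=> s' g; apply: none; exists x'.
case: (bad x sx) => i j iN jN iS jS xi xj.
have [sLi|nLi] := boolP ([set a; b] \subset L i); first by left.
have [sLj|nLj] := boolP ([set a; b] \subset L j); first by right.
have sub2 p q k : p \in L k -> q \in L k -> [set p; q] \subset L k.
  by move=> pL qL; apply/subsetP=> z; rewrite !inE => /orP[] /eqP->.
have xij : x i != x j by apply: contraTneq iS => /sx.2->.
have Li := sx.1 _ iN; have Lj := sx.1 _ jN.
exfalso; apply: nstuck; move: xi xj; rewrite !inE.
case/orP=> /eqP Ei; case/orP=> /eqP Ej; rewrite Ei Ej ?eqxx // in Li Lj xij.
- apply: (@bad_stuck a b x i j) => //.
    by apply: contra nLi; apply: sub2.
  by apply: contra nLj => ?; apply: sub2.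
- apply/flC/(@bad_stuck b a x i j) => //.
  + by apply: contra nLi => ?; apply: sub2.
  + by apply: contra nLj; apply: sub2.
  + by move=> x' s' /goodC; apply: bad.
Qed.
End Good.

(** * Flips of partial edge colourings *)

Section PairColouring.
Variables (V T : finType).

(* Colours of ordered pairs of vertices; [None] on non-edges. *)
Definition pcol := {ffun V * V -> option T}.
Implicit Types (c d : pcol) (C : {set V}) (e : rel V).

Definition kcol e c :=
  [/\ forall p q, c (p, q) = c (q, p), forall p q, isSome (c (p, q)) = e p q
    & forall p q r t, c (p, q) = Some t -> c (p, r) = Some t -> q = r].

(** For symmetric [c], such a [C] is a union of vertex sets of components of the [a], [b] edges. *)
Definition ab_closed c a b C := forall p q,
  p \in C -> c (p, q) \in [:: Some a; Some b] -> q \in C.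

(** Testing the first endpoint suffices: both ends of an [a] or [b] edge lie on the same side of a
    closed set, and other colours are fixed. *)
Definition flip c a b C : pcol :=
  [ffun p => if p.1 \in C then omap (tperm a b) (c p) else c p].

(** A flip may act on several components or on none; [flip_edges] splits it into single Kempe
    changes. *)
Inductive keq c : pcol -> Prop :=
| keq0 : keq c c
| keqS d a b C : a != b -> ab_closed d a b C -> keq c d -> keq c (flip d a b C).

Lemma tperm_id (a b t : T) : t \notin [set a; b] -> tperm a b t = t.
Proof.
by rewrite !inE negb_or => /andP[ta tb]; rewrite tpermD // eq_sym.
Qed.

Lemma omap_tperm_id a b (o : option T) :
  o \notin [:: Some a; Some b] -> omap (tperm a b) o = o.
Proof. by case: o => //= t H; rewrite tperm_id //; move: H; rewrite !inE. Qed.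

Lemma omap_tperm_in a b (o : option T) :
  (omap (tperm a b) o \in [:: Some a; Some b]) = (o \in [:: Some a; Some b]).
Proof.
case: o => //= t; have := tperm_in a b t.
by rewrite !inE.
Qed.

Lemma flip_in c a b C p q :
  (flip c a b C (p, q) \in [:: Some a; Some b]) = (c (p, q) \in [:: Some a; Some b]).
Proof. by rewrite ffunE; case: ifP => //; rewrite omap_tperm_in. Qed.

Lemma ab_closed_flip c a b C : ab_closed c a b C -> ab_closed (flip c a b C) a b C.
Proof. by move=> H p q pC; rewrite flip_in; apply: H. Qed.

Lemma flipK c a b C : flip (flip c a b C) a b C = c.
Proof.
apply/ffunP=> p; rewrite !ffunE; case: (p.1 \in C) => //.
by case: (c p) => //= t; rewrite tpermK.
Qed.

Lemma flip0 c a b : flip c a b set0 = c.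
Proof. by apply/ffunP=> p; rewrite ffunE inE. Qed.

Lemma keq1 c a b C : a != b -> ab_closed c a b C -> keq c (flip c a b C).
Proof. by move=> ab cl; apply: keqS => //; apply: keq0. Qed.

Lemma keq_trans c2 c1 c3 : keq c1 c2 -> keq c2 c3 -> keq c1 c3.
Proof. by move=> H; elim=> // d a b C ab cl _; apply: keqS. Qed.

Lemma keq_sym c d : keq c d -> keq d c.
Proof.
elim=> [|c' a b C ab cl _ IH]; first exact: keq0.
apply: keq_trans IH; rewrite -{2}(flipK c' a b C).
by apply: keq1 => //; apply: ab_closed_flip.
Qed.

Lemma ab_closed_eq e c a b C p q : kcol e c -> ab_closed c a b C ->
  c (p, q) \in [:: Some a; Some b] -> (p \in C) = (q \in C).
Proof.
case=> sym _ _ cl H; apply/idP/idP=> H'; first exact: cl H.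
by apply: cl H' _; rewrite sym.
Qed.

Lemma flip_kcol e c a b C : kcol e c -> ab_closed c a b C ->
  kcol e (flip c a b C).
Proof.
move=> kc cl; have [sym dom inj] := kc; split=> [p q|p q|p q r t].
- rewrite !ffunE /= [c (q, p)]sym; have [H|H] := boolP (c (p, q) \in [:: Some a; Some b]).
    by rewrite (ab_closed_eq kc cl H).
  by rewrite omap_tperm_id // !if_same.
- by rewrite ffunE -dom /=; case: ifP => //; case: (c _).
- rewrite !ffunE /=; case: ifP => _; last exact: inj.
  case Eq: (c (p, q)) => [u|] //= [Eu]; case Er: (c (p, r)) => [w|] //= [Ew].
  apply: (inj p q r u) => //; rewrite Er; congr Some.
  by apply: (@perm_inj _ (tperm a b)); rewrite Eu.
Qed.

Definition free c p : {set T} := [set t | [forall q, c (p, q) != Some t]].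

Lemma freeP c p t : reflect (forall q, c (p, q) != Some t) (t \in free c p).
Proof. by rewrite inE; apply: forallP. Qed.

Lemma free_flip c a b C p : free (flip c a b C) p = flip_lists C (free c) a b p.
Proof.
rewrite /flip_lists; have [pC|pC] := boolP (p \in C); last first.
  by apply/setP=> t; rewrite !inE; apply: eq_forallb => q; rewrite ffunE /= (negbTE pC).
apply/setP=> t; rewrite -[t](tpermK a b) (mem_imset _ _ (@perm_inj _ _)) !inE.
apply: eq_forallb => q; rewrite ffunE /= pC; congr negb.
case: (c (p, q)) => [u|] //=; apply/eqP/eqP => -[]; last by move=> ->.
by move/perm_inj=> ->.
Qed.

Lemma free2_notin c a b p q : [set a; b] \subset free c p ->
  c (p, q) \notin [:: Some a; Some b].
Proof.
move/subsetP=> H; rewrite !inE negb_or.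
by rewrite (freeP _ _ _ (H a _)) ?(freeP _ _ _ (H b _)) ?inE ?eqxx ?orbT.
Qed.

Lemma flipC c a b x y C K : [disjoint [set a; b] & [set x; y]] ->
  flip (flip c a b C) x y K = flip (flip c x y K) a b C.
Proof.
move=> dis; apply/ffunP=> p; rewrite !ffunE; case: (p.1 \in C); case: (p.1 \in K) => //.
case: (c p) => //= t; congr Some.
have [tab|tab] := boolP (t \in [set a; b]).
  have H u : u \in [set a; b] -> tperm x y u = u.
    by move=> uab; rewrite tperm_id // (disjointFr dis).
  by rewrite !H // tperm_in.
rewrite (tperm_id tab); have [txy|txy] := boolP (t \in [set x; y]).
  by rewrite [RHS]tperm_id // (disjointFl dis) // tperm_in.
by rewrite tperm_id // tperm_id.
Qed.

Lemma flip_in_disjoint c a b x y K p q : [disjoint [set a; b] & [set x; y]] ->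
  (flip c x y K (p, q) \in [:: Some a; Some b]) = (c (p, q) \in [:: Some a; Some b]).
Proof.
move=> dis; rewrite ffunE /=; case: ifP => // _.
have E t : (Some t \in [:: Some a; Some b]) = (t \in [set a; b]) by rewrite !inE.
case: (c (p, q)) => // t; rewrite /= !E.
have [txy|txy] := boolP (t \in [set x; y]); last by rewrite tperm_id.
by rewrite !(disjointFl dis) // tperm_in.
Qed.

Lemma ab_closed_flip_disjoint c a b x y C K : [disjoint [set a; b] & [set x; y]] ->
  ab_closed c a b C -> ab_closed (flip c x y K) a b C.
Proof. by move=> dis H p q pC; rewrite flip_in_disjoint //; apply: H. Qed.

(** Sending a colour present at [p] to the far end of its edge is injective. *)
Lemma kcol_colours_subset e c p : kcol e c ->
  #|T| <= #|free c p| + #|[set q | e p q]|.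
Proof.
move=> [sym dom inj]; rewrite -(cardsC (free c p)) leq_add2l.
pose f t := odflt p [pick q | c (p, q) == Some t].
have fP t : t \in ~: free c p -> c (p, f t) = Some t.
  rewrite !inE negb_forall => /existsP[q]; rewrite negbK => cq.
  by rewrite /f; case: pickP => [r /eqP|/(_ q)] //; rewrite cq.
rewrite -(@card_in_imset _ _ f) => [|t u /fP ft /fP fu E].
  apply: subset_leq_card; apply/subsetP=> _ /imsetP[t /fP ft ->].
  by rewrite inE -dom ft.
by move: fu; rewrite -E ft => -[].
Qed.

(* In a component of colours [a], [b] the vertices are visited by the walk from
   an end [p] that leaves along alternating colours; it stalls at the other end. *)
Section Walk.
Variables (e : rel V) (c : pcol) (a b : T) (p : V).
Hypotheses (kc : kcol e c) (pa : a \in free c p).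

(** Staying at [x] when [t] is free there makes [nbr t] an involution. Colour [b] comes first
    because [a] is free at [p]. *)
Let nbr t x := odflt x [pick y | c (x, y) == Some t].
Let col n := if odd n then a else b.
Fixpoint walk n := if n is n'.+1 then nbr (col n') (walk n') else p.

Let nbrP t x y : c (x, y) = Some t -> nbr t x = y.
Proof.
have [_ _ inj] := kc.
move=> cxy; rewrite /nbr; case: pickP => [z /eqP cxz|/(_ y)] /=.
  exact: inj cxz cxy.
by rewrite cxy eqxx.
Qed.

Let nbr_or t x : c (x, nbr t x) = Some t \/ (nbr t x = x /\ t \in free c x).
Proof.
rewrite /nbr; case: pickP => [z /eqP|none] /=; [by left|right; split=> //].
by apply/freeP=> q; rewrite none.
Qed.

Let nbrK t x : nbr t (nbr t x) = x.
Proof.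
have [sym _ _] := kc; case: (nbr_or t x) => [H|[E _]]; last by rewrite !E.
by apply: nbrP; rewrite sym.
Qed.

Let nbr_free t x : t \in free c x -> nbr t x = x.
Proof.
by move/freeP=> fr; case: (nbr_or t x) => [H|[]//]; have := fr (nbr t x); rewrite H eqxx.
Qed.

(** At [n = 0] the predecessor [0.-1] is again [0], in accordance with [nbr a p = p]. *)
Let nbr_walk t n : t = a \/ t = b ->
  nbr t (walk n) = walk n.+1 \/ nbr t (walk n) = walk n.-1.
Proof.
move=> tab; have [->|] := eqVneq t (col n); first by left.
case: n => [|n] H; first by case: tab H => -> /eqP // _; right; apply: nbr_free.
right; rewrite /= (_ : t = col n) ?nbrK //.
by move: H; rewrite /col /=; case: tab => ->; case: (odd n) => //=; rewrite eqxx.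
Qed.

Let comp := connect (fun x y => c (x, y) \in [:: Some a; Some b]) p.

(** [None] asks for no bound; [Some x] is for a walk that stalls at index [x], whose indices up to
    [x] already cover the component. *)
Lemma walk_closed m : (forall x, m = Some x -> walk x.+1 = walk x) ->
  forall z, comp z -> exists2 n, walk n = z & if m is Some x then n <= x else true.
Proof.
move=> stall z /connectP[s]; elim/last_ind: s z => [|s y IH] z.
  by move=> _ ->; exists 0 => //; case: m stall.
rewrite rcons_path last_rcons => /andP[ps cy] ->.
have {IH} [n En nm] := IH _ ps erefl.
have [t tab ct] : exists2 t, t = a \/ t = b & c (last p s, y) = Some t.
  by move: cy; rewrite !inE => /orP[] /eqP E; [exists a|exists b]; auto.
have Ey := nbrP ct; rewrite -En in Ey.
case: (nbr_walk n tab) => Ew; rewrite Ew in Ey; last first.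
  by exists n.-1 => //; case: m stall nm => // x _ nm; apply: leq_trans (leq_pred n) nm.
case: m stall nm => [x stall|_ _]; last by exists n.+1.
rewrite leq_eqVlt => /orP[/eqP nx|lt]; last by exists n.+1.
by exists n; rewrite -?Ey nx // stall.
Qed.

(** The component is a path ending at [p], and a vertex other than [p] that lacks [a] is its other
    end. The walk stalls at the first such vertex: it cannot have arrived along [a], so it would
    have to leave along [a]. *)
Lemma two_ends y z : y != p -> z != p -> a \in free c y -> a \in free c z ->
  comp y -> comp z -> y = z.
Proof.
move=> yp zp ya za cy cz.
pose end_at n := (walk n != p) && (a \in free c (walk n)).
have endE w : w != p -> a \in free c w -> comp w -> exists2 n, walk n = w & end_at n.
  move=> wp wa cw; have [//|n En _] := @walk_closed None _ w cw.
  by exists n; rewrite /end_at En ?wp.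
have ex : exists n, end_at n by have [n _ En] := endE y yp ya cy; exists n.
case: (ex_minnP ex) => n en nmin.
have ngt w : w != p -> a \in free c w -> comp w -> w = walk n.
  move=> wp wa cw.
  have stall : walk n.+1 = walk n.
    case: n en nmin => [|n] en nmin; first by case/andP: en; rewrite /= eqxx.
    case/andP: en => wn fn.
    have Hb : col n.+1 = a.
      rewrite /col /=; case on: (odd n) => //=; exfalso.
      have W : walk n.+1 = nbr a (walk n) by rewrite /= /col on.
      have E : walk n = walk n.+1 by rewrite -[LHS](nbrK a) -W nbr_free.
      have := nmin n; rewrite /end_at E wn fn => /(_ isT); by rewrite ltnn.
    by rewrite [LHS]/= Hb; apply: nbr_free.
  have [x [<-] //|m Em mn] := @walk_closed (Some n) _ w cw.
  rewrite -Em; congr walk; apply/eqP; rewrite eqn_leq mn; apply: nmin.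
  by rewrite /end_at Em wp.
by rewrite (ngt y) // (ngt z).
Qed.
End Walk.

End PairColouring.

(** * Deleting a vertex *)

Section Deletion.
Variables (V T : finType) (e : rel V) (v : V) (D : nat).
Hypotheses (e_sym : symmetric e) (e_irr : irreflexive e).
Hypotheses (degD : forall p, #|[set q | e p q]| <= D) (D4 : D <= 4).
Hypothesis TD : D.+2 <= #|T|.
Implicit Types (c d psi : pcol V T).

Let N := [set q | e v q].

(** [v] stays as an isolated vertex, so that the induction keeps the type [V]. *)
Definition del_rel : rel V := fun p q => [&& e p q, p != v & q != v].

Definition del c : pcol V T :=
  [ffun p => if (p.1 == v) || (p.2 == v) then None else c p].

Definition ext psi (x : V -> T) : pcol V T :=
  [ffun p => if p.1 == v then (if p.2 \in N then Some (x p.2) else None)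
             else if p.2 == v then (if p.1 \in N then Some (x p.1) else None)
             else psi p].

Let vN : v \notin N. Proof. by rewrite inE e_irr. Qed.

Let Nv p : p \in N -> p != v.
Proof. by apply: contraTneq => ->. Qed.

Lemma del_kcol c : kcol e c -> kcol del_rel (del c).
Proof.
case=> sym dom inj; split=> [p q|p q|p q r t]; rewrite !ffunE /=.
- by rewrite sym orbC.
- by rewrite /del_rel -dom; case: (p == v); case: (q == v); rewrite ?andbF ?andbT.
- by do 2![case: ifP => // _]; apply: inj.
Qed.

Lemma kcol_del_None psi p q : kcol del_rel psi -> (p == v) || (q == v) ->
  psi (p, q) = None.
Proof.
case=> _ dom _ H; have := dom p q; rewrite /del_rel.
by case: (psi _) => //= t; case/orP: H => ->; rewrite ?andbF.
Qed.

Lemma free_del_v psi t : kcol del_rel psi -> t \in free psi v.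
Proof. by move=> k; apply/freeP=> q; rewrite (kcol_del_None k) ?eqxx. Qed.

Lemma ext_kcol psi x : kcol del_rel psi -> sdr N (free psi) x ->
  kcol e (ext psi x).
Proof.
move=> kp [xL xI]; have [sym dom inj] := kp; split=> [p q|p q|p q r t].
- rewrite !ffunE /= sym; case: eqP => [->|_]; case: eqP => // ->.
  by rewrite (negbTE vN).
- rewrite ffunE /=; case: eqP => [->|/eqP pv]; first by rewrite inE; case: (e v q).
  case: eqP => [->|/eqP qv]; first by rewrite inE e_sym; case: (e p v).
  by rewrite dom /del_rel pv qv !andbT.
- rewrite !ffunE /=; case: eqP => [_|_].
    case: ifP => // qN [<-]; case: ifP => // rN [/esym]; exact: xI.
  have fr z w : p \in N -> psi (p, w) <> Some (x z) \/ z != p.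
    move=> pN; have [->|] := eqVneq z p; [left|by right].
    by have /freeP/(_ w)/eqP := xL p pN.
  case: (q =P v) => [->|_]; case: (r =P v) => [->|_] //; last exact: inj.
    by case: ifP => // pN [<-]; case: (fr p r pN); rewrite ?eqxx.
  by move=> H; case: ifP => // pN [E]; case: (fr p q pN); rewrite ?eqxx // E.
Qed.

Lemma del_ext psi x : kcol del_rel psi -> del (ext psi x) = psi.
Proof.
move=> kp; apply/ffunP=> -[p q]; rewrite !ffunE /=.
by case: ifP => [/(kcol_del_None kp)|/norP[/negbTE-> /negbTE->]].
Qed.

Lemma ext_eq psi x y : {in N, x =1 y} -> ext psi x = ext psi y.
Proof.
move=> E; apply/ffunP=> -[p q]; rewrite !ffunE /=.
case: ifP => _; first by case: ifP => // qN; rewrite E.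
by case: ifP => // _; case: ifP => // qN; rewrite E.
Qed.

Let t0 : T.
Proof. by case: (pickP (@predT T)) => // /eq_card0 E; move: TD; rewrite E. Qed.

Lemma ext_del c : kcol e c ->
  exists2 x, sdr N (free (del c)) x & c = ext (del c) x.
Proof.
move=> kc; have [sym dom inj] := kc.
pose x q := odflt t0 (c (v, q)).
have xP q : q \in N -> c (v, q) = Some (x q).
  by rewrite inE -dom /x; case: (c _).
exists x.
  split=> [q qN|q r qN rN E].
    apply/freeP=> r; rewrite ffunE /= (negbTE (Nv qN)) /=.
    case: (r =P v) => // rv; apply/eqP=> H; apply: rv.
    by apply: (inj q _ _ _ H); rewrite sym xP.
  by apply: (inj v _ _ (x q)); rewrite xP // E.
have out q : q \notin N -> c (v, q) = None.
  by rewrite inE -dom; case: (c _).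
apply/ffunP=> -[p q]; rewrite !ffunE /=; case: (p =P v) => [->|_].
  by case: ifP => [/xP|/negbT/out].
case: (q =P v) => [->|//]; rewrite sym.
by case: ifP => [/xP|/negbT/out].
Qed.

(** The flipped set is [K] with [v] and the ends of its [a], [b] edges adjoined. A neighbour added
    from outside [K] has both colours free in [psi], so it brings in no further edge. *)
Lemma flip_ext_through psi x a b K : kcol del_rel psi -> sdr N (free psi) x ->
  ab_closed psi a b K ->
  (forall z, z \in N -> x z \in [set a; b] ->
     z \in K \/ [set a; b] \subset free psi z) ->
  let C := v |: (K :|: [set z in N | x z \in [set a; b]]) in
  ab_closed (ext psi x) a b C /\
  flip (ext psi x) a b C = ext (flip psi a b K) (fun z => tperm a b (x z)).
Proof.
move=> kp sx cl H C.
have Some_in t : (Some t \in [:: Some a; Some b]) = (t \in [set a; b]).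
  by rewrite !inE.
have inC z : (z \in C) = [|| z == v, z \in K | (z \in N) && (x z \in [set a; b])].
  by rewrite !inE.
have CE p q : p != v -> psi (p, q) \in [:: Some a; Some b] -> (p \in C) = (p \in K).
  move=> pv pq; rewrite inC (negbTE pv) /=; case pK: (p \in K) => //=.
  apply/negP=> /andP[pN xp]; case: (H p pN xp); rewrite ?pK //.
  by move/(free2_notin q); rewrite pq.
split.
  move=> p q pC; rewrite ffunE /=; case: (p =P v) => [_|/eqP pv].
    by case: ifP => // qN; rewrite Some_in => xq; rewrite inC qN xq !orbT.
  case: (q =P v) => [->|/eqP qv]; first by rewrite inC eqxx.
  move=> pq; rewrite (CE p q) // in pC.
  by rewrite inC (cl p q) ?orbT.
apply/ffunP=> -[p q]; rewrite ![in LHS]ffunE [in RHS]ffunE /=.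
case: (p =P v) => [->|/eqP pv]; first by rewrite inC eqxx; case: ifP.
case: (q =P v) => [_|/eqP qv].
  case pN: (p \in N); last by rewrite /= if_same.
  case: ifP => // /negbT pC; congr Some; rewrite tperm_id //.
  by apply: contra pC => xp; rewrite inC pN xp !orbT.
rewrite ffunE /=; have [pq|pq] := boolP (psi (p, q) \in [:: Some a; Some b]).
  by rewrite (CE p q).
by rewrite omap_tperm_id // !if_same.
Qed.

(** Vertices with both colours free, such as [v], are left out of [K]. This loses no [a] or [b] edge
    of [psi] and separates the rest from [v], whose edges keep their colours. *)
Lemma flip_ext_avoiding psi x a b K : kcol del_rel psi -> sdr N (free psi) x ->
  ab_closed psi a b K ->
  (forall z, z \in N -> x z \in [set a; b] -> z \in K ->
     [set a; b] \subset free psi z) ->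
  let C := [set z in K | ~~ ([set a; b] \subset free psi z)] in
  ab_closed (ext psi x) a b C /\
  flip (ext psi x) a b C = ext (flip psi a b K) x.
Proof.
move=> kp sx cl H C; have [sym _ _] := kp.
have Some_in t : (Some t \in [:: Some a; Some b]) = (t \in [set a; b]).
  by rewrite !inE.
have vC : v \notin C.
  rewrite inE negb_and negbK; apply/orP; right.
  by apply/subsetP=> t _; apply: free_del_v.
have CE p q : psi (p, q) \in [:: Some a; Some b] -> (p \in C) = (p \in K).
  move=> pq; rewrite inE andb_idr // => _.
  by apply: contraL pq => /free2_notin.
have CN p : p \in C -> p \in N -> x p \notin [set a; b].
  by rewrite inE => /andP[pK pf] pN; apply: contra pf => xp; apply: H.
split.
  move=> p q pC; rewrite ffunE /=; case: (p =P v) => [pv|_].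
    by rewrite -pv pC in vC.
  case: (q =P v) => [_|/eqP qv].
    by case: ifP => // pN; rewrite Some_in => xp; have := CN p pC pN; rewrite xp.
  move=> pq; have qp : psi (q, p) \in [:: Some a; Some b] by rewrite sym.
  by rewrite (CE q p) //; rewrite (CE p q) // in pC; apply: cl pC pq.
apply/ffunP=> -[p q]; rewrite ![in LHS]ffunE [in RHS]ffunE /=.
case: (p =P v) => [->|/eqP pv]; first by rewrite (negbTE vC).
case: (q =P v) => [_|/eqP qv].
  case pN: (p \in N); last by rewrite /= if_same.
  by case: ifP => // pC; rewrite /= tperm_id // CN.
rewrite ffunE /=; have [pq|pq] := boolP (psi (p, q) \in [:: Some a; Some b]).
  by rewrite (CE p q).
by rewrite omap_tperm_id // !if_same.
Qed.

(** Both moves are flips through [v] with [K] empty: an update recolours the single edge to [i], a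
    swap the path from [i] through [v] to [j]. *)
Lemma reconf_keq psi x y : kcol del_rel psi -> sdr N (free psi) x ->
  reconf N (free psi) x y -> keq (ext psi x) (ext psi y).
Proof.
move=> kp + r; elim: r => {x y} [x y E _|x y i t iN tL fr _ IH sx|x y i j iN jN ij xj xi _ IH sx].
- by rewrite (ext_eq psi E); apply: keq0.
- apply: keq_trans (IH (sdr_upd sx iN tL fr)).
  have cl0 : ab_closed psi (x i) t set0 by move=> p q; rewrite inE.
  have sub : [set x i; t] \subset free psi i.
    by apply/subsetP=> u; rewrite !inE => /orP[] /eqP->; [have := sx.1 i iN|move: tL]; rewrite inE.
  have [z zN zx|cl E] := flip_ext_through kp sx cl0.
    right; move: zx; rewrite !inE => /orP[/eqP/sx.2 ->//|/eqP E].
    by have := fr z zN; rewrite E eqxx.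
  rewrite flip0 in E; rewrite (_ : ext psi (upd x i t) = ext psi (fun z => tperm (x i) t (x z))).
    by rewrite -E; apply: keq1 => //; apply: fr.
  apply: ext_eq => z zN; rewrite /upd; case: (z =P i) => [->|zi]; first by rewrite tpermL.
  rewrite tpermD // eq_sym ?fr //.
  by apply/eqP=> /sx.2-/(_ zN iN).
- apply: keq_trans (IH (sdr_swp sx iN jN ij xj xi)).
  have cl0 : ab_closed psi (x i) (x j) set0 by move=> p q; rewrite inE.
  have xij : x i != x j by apply: contra_neq ij; apply: sx.2.
  have sub k : k = i \/ k = j -> [set x i; x j] \subset free psi k.
    by case=> ->; apply/subsetP=> u; rewrite in_set2 => /orP[] /eqP-> //; apply: sx.1.
  have [z zN zx|cl E] := flip_ext_through kp sx cl0.
    right; apply: sub; move: zx; rewrite !inE.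
    by case/orP=> /eqP/sx.2 ->; auto.
  rewrite flip0 in E; rewrite (_ : ext psi (swp x i j) = ext psi (fun z => tperm (x i) (x j) (x z))).
    by rewrite -E; apply: keq1.
  apply: ext_eq => z zN; rewrite /swp /upd; case: (z =P j) => [->|/eqP zj]; first by rewrite tpermR.
  case: (z =P i) => [->|/eqP zi]; first by rewrite tpermL.
  by rewrite tpermD //; [apply: contra_neq zi|apply: contra_neq zj] => /sx.2->.
Qed.

Let N4 : #|N| <= 4. Proof. exact: leq_trans (degD v) D4. Qed.

(** Of at least [D.+2] colours at most [D.-1] are present at [i], since its edge to [v] is gone. *)
Lemma free3 psi i : kcol del_rel psi -> i \in N -> 3 <= #|free psi i|.
Proof.
move=> kp iN; have le := leq_trans TD (kcol_colours_subset i kp).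
have vi : v \in [set q | e i q] by rewrite inE e_sym; move: iN; rewrite inE.
have := degD i; rewrite (cardsD1 v) vi add1n => lt.
have : #|[set q | del_rel i q]| <= #|[set q | e i q] :\ v|.
  apply: subset_leq_card; apply/subsetP=> q; rewrite !inE /del_rel.
  by case/and3P=> -> _ ->.
move: le lt; set A := #|free _ _|; set B := #|_|; set B' := #|_|.
move=> le lt le'; rewrite -(leq_add2r B).
apply: leq_trans le; apply: leq_trans (_ : B'.+3 <= _); last by [].
by rewrite addnC addn3 !ltnS.
Qed.

Lemma sdr_not_stuck psi x : sdr N (free psi) x -> ~ stuck N (free psi).
Proof.
move=> [xL xI] [c4 [A cA HA]].
have : #|x @: N| <= #|A|.
  by apply: subset_leq_card; apply/subsetP=> _ /imsetP[i iN ->]; rewrite -(HA i iN) xL.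
by rewrite card_in_imset // c4 cA.
Qed.

Lemma keq_same_del c d : kcol e c -> kcol e d -> del c = del d -> keq c d.
Proof.
move=> kc kd E; have [x sx Ex] := ext_del kc; have [y sy Ey] := ext_del kd.
have kp := del_kcol kc; rewrite Ex Ey -E; rewrite -E in sy.
apply: reconf_keq => //; apply: sdr_reconf => // i iN; exact: free3.
Qed.

(** Since [d] extends the flipped colouring, [good_sdr] yields an extension of [del c] along which
    the flip lifts. Before and after it, only edges at [v] need changing, by [keq_same_del]. *)
Lemma keq_del_flip c d a b K : kcol e c -> kcol e d -> a != b ->
  ab_closed (del c) a b K -> del d = flip (del c) a b K -> keq c d.
Proof.
move=> kc kd ab cl E; have kp := del_kcol kc.
have [x sx _] := ext_del kc; have [y sy _] := ext_del kd.
have nst : ~ stuck N (flip_lists K (free (del c)) a b).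
  move=> [c4 [A cA HA]]; apply: (sdr_not_stuck sy); split=> //.
  by exists A => // i iN; rewrite E free_flip HA.
have [x' sx' gx] := good_sdr N4 (fun i => @free3 _ i kp) ab sx nst.
have fin C z : ab_closed (ext (del c) x') a b C ->
    flip (ext (del c) x') a b C = ext (flip (del c) a b K) z -> keq c d.
  move=> clC EC; have ke := ext_kcol kp sx'.
  apply: (@keq_trans _ _ (ext (del c) x')).
    by apply: keq_same_del => //; rewrite del_ext.
  apply: (keq_trans (keq1 ab clC)); apply: keq_same_del => //.
    exact: flip_kcol.
  by rewrite E EC del_ext //; apply: flip_kcol.
(* If such an [i] exists, goodness gives both free colours to every [a], [b] neighbour of [v]
   outside [K], and the flip passes through [v]. Otherwise it can avoid [v]. *)
have [/exists_inP[i iN /and3P[iK xi ni]]|none] := boolP [exists i in N,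
    [&& i \in K, x' i \in [set a; b] & ~~ ([set a; b] \subset free (del c) i)]].
  have [|clC EC] := flip_ext_through kp sx' cl; last exact: fin clC EC.
  move=> z zN xz; have [zK|zK] := boolP (z \in K); [by left|right].
  by case: (gx i z iN zN iK zK xi xz) => // ti; rewrite ti in ni.
have [|clC EC] := flip_ext_avoiding kp sx' cl; last exact: fin clC EC.
move=> z zN xz zK; apply: contraR none => nz.
by apply/exists_inP; exists z; rewrite // zK xz.
Qed.

(** * Stuck colourings and exits from them *)

Definition over psi c := kcol e c /\ del c = psi.

Lemma overP psi : kcol del_rel psi -> (exists c, over psi c) \/ stuck N (free psi).
Proof.
move=> kp; case: (sdr_or_stuck t0 N4 (fun i => @free3 _ i kp)) => [[x sx]|st].
  by left; exists (ext psi x); split; [apply: ext_kcol|apply: del_ext].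
by right.
Qed.

Lemma over_diff psi y z t : kcol del_rel psi -> y \in N -> z \in N ->
  t \in free psi y -> t \notin free psi z -> exists c, over psi c.
Proof.
move=> kp yN zN ty tz; case: (overP kp) => // -[_ [A _ HA]].
by rewrite !HA // in ty tz; rewrite ty in tz.
Qed.

Definition stuck_at psi (A : {set T}) :=
  [/\ #|N| = 4, #|A| = 3 & forall i, i \in N -> free psi i = A].

Definition exit psi a b (M : {set V}) := ab_closed psi a b M /\
  exists y z, [/\ y \in N, z \in N, y \in M & z \notin M].

(** [a] is free at all four neighbours of [v], so by [two_ends] the component of one of them
    contains at most one other. *)
Lemma exit_exists psi A a b : kcol del_rel psi -> stuck_at psi A ->
  a \in A -> b \notin A -> exists M, exit psi a b M.
Proof.
move=> kp [c4 cA HA] aA bA.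
have /card_gt0P[y yN] : 0 < #|N| by rewrite c4.
set r := fun p q => psi (p, q) \in [:: Some a; Some b].
exists [set z | connect r y z]; split.
  move=> p q; rewrite !inE => /connect_trans H pq; apply: H.
  by apply: connect1; rewrite /r !inE.
suff [z zN nz] : exists2 z, z \in N & ~~ connect r y z.
  by exists y, z; split=> //; rewrite in_set ?connect0.
apply/exists_inP; rewrite -negb_forall_in; apply/negP=> /forall_inP all.
have [z [/= zN zy _]] : exists z, [/\ z \in N, z != y & z != y].
  by apply: card3_third; rewrite c4.
have [w [wN wy wz]] : exists w, [/\ w \in N, w != y & w != z].
  by apply: card3_third; rewrite c4.
have fr i : i \in N -> a \in free psi i by move=> iN; rewrite HA.
by case/eqP: wz; apply: (two_ends kp (fr y yN) wy zy (fr w wN) (fr z zN)); apply: all.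
Qed.

(** After the exit [b] is free at [y], which was flipped, but not at [z]. *)
Lemma exit_over psi A a b M : kcol del_rel psi -> stuck_at psi A ->
  a \in A -> b \notin A -> exit psi a b M -> exists c, over (flip psi a b M) c.
Proof.
move=> kp [c4 cA HA] aA bA [cl [y [z [yN zN yM zM]]]].
apply: (@over_diff _ y z b) => //; first exact: flip_kcol.
  by rewrite free_flip /flip_lists yM HA // -{1}(tpermL a b) mem_imset //; apply: perm_inj.
by rewrite free_flip /flip_lists (negbTE zM) HA.
Qed.

Lemma disjoint2 (a b x y : T) : a != x -> a != y -> b != x -> b != y ->
  [disjoint [set a; b] & [set x; y]].
Proof.
move=> ax ay bx by_; rewrite disjoint_subset; apply/subsetP=> t.
by rewrite !inE => /orP[] /eqP->; rewrite negb_or ?ax ?ay ?bx ?by_.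
Qed.

Lemma free_flip_other psi x y K p t : t != x -> t != y ->
  (t \in free (flip psi x y K) p) = (t \in free psi p).
Proof.
move=> tx ty; rewrite free_flip /flip_lists; case: ifP => // _.
by rewrite -{1}(tpermD (x:=x) (y:=y) (z:=t)) 1?eq_sym // mem_imset //; apply: perm_inj.
Qed.

Section StuckStep.
Variables (psi : pcol V T) (A : {set T}).
Hypotheses (kp : kcol del_rel psi) (st : stuck_at psi A).

(** The change on [x], [y] leaves [b] free at [u] and not at [w], so the doubly flipped colouring
    still extends. *)
Lemma exit_commute x y K a b M c : x != y -> ab_closed psi x y K ->
  a \in A -> b \notin A -> [disjoint [set a; b] & [set x; y]] ->
  exit psi a b M -> over (flip psi a b M) c ->
  exists2 d, over (flip (flip psi x y K) a b M) d & keq c d.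
Proof.
move=> xy cl aA bA dis ex [kc Ec]; have [clM [u [w [uN wN uM wM]]]] := ex.
have [_ _ HA] := st.
have cl' : ab_closed (flip psi a b M) x y K.
  by apply: ab_closed_flip_disjoint => //; rewrite disjoint_sym.
have [d [kd Ed]] : exists d, over (flip (flip psi a b M) x y K) d.
  have [bx by_] : b != x /\ b != y.
    move: dis; rewrite disjoint_subset => /subsetP/(_ b).
    by rewrite !inE eqxx orbT negb_or => /(_ isT)/andP.
  apply: (@over_diff _ u w b) => //; first by do 2!apply: flip_kcol => //.
    rewrite free_flip_other // free_flip /flip_lists uM HA // -{1}(tpermL a b).
    by rewrite mem_imset //; apply: perm_inj.
  by rewrite free_flip_other // free_flip /flip_lists (negbTE wM) HA.
exists d; first by rewrite flipC // disjoint_sym.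
by apply: (keq_del_flip (a:=x) (b:=y) (K:=K)) => //; rewrite Ec.
Qed.

(** Two commuting flips form a square whose only stuck corner is [psi]; the path goes around the
    other three. *)
Lemma exit_keq_disjoint x y K a b M c d : x != y -> ab_closed psi x y K ->
  a \in A -> b \notin A -> [disjoint [set a; b] & [set x; y]] ->
  exit psi a b M -> over (flip psi a b M) c -> over (flip psi x y K) d ->
  keq c d.
Proof.
move=> xy cl aA bA dis ex oc [kd Ed].
have [d' [kd' Ed'] H] := exit_commute xy cl aA bA dis ex oc.
apply: (keq_trans H); apply: keq_sym.
apply: (keq_del_flip (a:=a) (b:=b) (K:=M)) => //.
- by apply: contraNneq bA => <-.
- by rewrite Ed; apply: ab_closed_flip_disjoint => //; case: ex.
- by rewrite Ed.
Qed.

(** A stuck [v] has degree four, so there are at least six colours: three in [A] and at least three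
    outside. Two forbidden on each side leave a choice. *)
Lemma far_exit p q r s : exists a b M c,
  [/\ a \in A /\ b \notin A, a != p /\ a != q, b != r /\ b != s, exit psi a b M
    & over (flip psi a b M) c].
Proof.
have [c4 cA _] := st.
have cAC : 3 <= #|~: A|.
  rewrite -(leq_add2l #|A|) cardsC cA; apply: leq_trans TD; rewrite !ltnS.
  by rewrite -c4; apply: degD.
have [|a [aA ap aq]] := @card3_third _ A p q; first by rewrite cA.
have [b [+ br bs]] := card3_third r s cAC; rewrite in_setC => bA.
have [M ex] := exit_exists kp st aA bA.
have [c oc] := exit_over kp st aA bA ex.
by exists a, b, M, c.
Qed.

Lemma mem_neq a b : a \in A -> b \notin A -> a != b.
Proof. by move=> aA; apply: contraNneq => <-. Qed.

(** Both exits are compared with a third one whose colours are disjoint from both pairs. *)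
Lemma exits_keq a b M c a' b' M' c' :
  a \in A -> b \notin A -> exit psi a b M -> over (flip psi a b M) c ->
  a' \in A -> b' \notin A -> exit psi a' b' M' -> over (flip psi a' b' M') c' ->
  keq c c'.
Proof.
move=> aA bA ex oc aA' bA' ex' oc'.
have [x [y [K [d [[xA yA] [xa xa'] [yb yb'] exd od]]]]] := far_exit a a' b b'.
apply: (@keq_trans _ _ d).
  apply/keq_sym/(exit_keq_disjoint (x:=a) (y:=b) _ _ xA yA _ exd od oc).
  - exact: mem_neq.
  - by case: ex.
  - by apply: disjoint2 => //; rewrite ?(mem_neq xA) // eq_sym mem_neq.
apply: (exit_keq_disjoint (x:=a') (y:=b') _ _ xA yA _ exd od oc').
- exact: mem_neq.
- by case: ex'.
- by apply: disjoint2 => //; rewrite ?(mem_neq xA) // eq_sym mem_neq.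
Qed.

Lemma exit_keq_flip a b M c x y K d : x != y -> ab_closed psi x y K ->
  a \in A -> b \notin A -> exit psi a b M -> over (flip psi a b M) c ->
  over (flip psi x y K) d -> keq c d.
Proof.
move=> xy cl aA bA ex oc od.
have [a' [b' [M' [c' [[aA' bA'] [ax ay] [bx by_] ex' oc']]]]] := far_exit x y x y.
apply: (keq_trans (exits_keq aA bA ex oc aA' bA' ex' oc')).
by apply: (exit_keq_disjoint xy cl aA' bA' _ ex' oc' od); apply: disjoint2.
Qed.
End StuckStep.

(** An exit on colours other than [x], [y] serves both stuck colourings, because [A] and [A'] agree
    off [x] and [y]. *)
Lemma exit_keq_exit psi A a b M c x y K A' a' b' M' c' :
  kcol del_rel psi -> x != y -> ab_closed psi x y K ->
  stuck_at psi A -> a \in A -> b \notin A -> exit psi a b M ->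
  over (flip psi a b M) c ->
  stuck_at (flip psi x y K) A' -> a' \in A' -> b' \notin A' ->
  exit (flip psi x y K) a' b' M' -> over (flip (flip psi x y K) a' b' M') c' ->
  keq c c'.
Proof.
move=> kp xy cl st aA bA ex oc st' aA' bA' ex' oc'.
have [u [w [L [d [[uA wA] [ux uy] [wx wy] exd od]]]]] := far_exit kp st x y x y.
apply: (keq_trans (exits_keq kp st aA bA ex oc uA wA exd od)).
have dis : [disjoint [set u; w] & [set x; y]] by apply: disjoint2.
have [d' od' H] := exit_commute kp st xy cl uA wA dis exd od.
apply: (keq_trans H).
have AA' t : t != x -> t != y -> (t \in A') = (t \in A).
  case: st st' => c4 _ HA [_ _ HA'] tx ty.
  have /card_gt0P[i iN] : 0 < #|N| by rewrite c4.
  by rewrite -(HA' i iN) -(HA i iN) free_flip_other.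
apply: (exits_keq _ st' _ _ _ od' aA' bA' ex' oc'); rewrite ?AA' //.
  exact: flip_kcol.
by case: exd => clL spl; split=> //; apply: ab_closed_flip_disjoint.
Qed.

(* The colourings of the whole graph attached to a colouring [psi] of the
   graph without [v]: its extensions, or, if it has none, the extensions of the
   colourings obtained from it by a single exit. *)
Definition near psi c := kcol e c /\ (del c = psi \/ exists A a b M,
  [/\ stuck_at psi A, a \in A, b \notin A, exit psi a b M & del c = flip psi a b M]).

Lemma near_flip psi a b K c d : kcol del_rel psi -> a != b ->
  ab_closed psi a b K -> near psi c -> near (flip psi a b K) d -> keq c d.
Proof.
move=> kp ab cl [kc [Ec|[A [x [y [M [st xA yA ex Ec]]]]]]] [kd [Ed|
  [A' [x' [y' [M' [st' xA' yA' ex' Ed]]]]]]].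
- by apply: (keq_del_flip (a:=a) (b:=b) (K:=K)) => //; rewrite Ec.
(* Only the flipped colouring is stuck here; [flipK] lets the change be read backwards. *)
- apply/keq_sym/(exit_keq_flip _ st' ab _ xA' yA' ex').
  + exact: flip_kcol.
  + exact: ab_closed_flip.
  + by split; rewrite ?Ed.
  + by rewrite flipK.
- by apply: (exit_keq_flip kp st ab cl xA yA ex).
- by apply: (exit_keq_exit kp ab cl st xA yA ex _ st' xA' yA' ex').
Qed.

Lemma near_exists psi : kcol del_rel psi -> exists c, near psi c.
Proof.
move=> kp; case: (overP kp) => [[c [kc E]]|[c4 [A cA HA]]].
  by exists c; split; auto.
have st : stuck_at psi A by [].
have [a [b [M [c [[aA bA] _ _ ex [kc E]]]]]] := far_exit kp st t0 t0 t0 t0.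
by exists c; split=> //; right; exists A, a, b, M.
Qed.

Lemma near_keq psi psi' c d : kcol del_rel psi -> keq psi psi' ->
  near psi c -> near psi' d -> keq c d.
Proof.
move=> kp H; elim: H d => [|psi1 a b K ab cl H IH] d nc nd.
  (* An empty flip on any two distinct colours makes the base case an instance of [near_flip]. *)
  have /card_gt1P[a [b [_ _ ab]]] : 1 < #|T| by apply: leq_trans TD.
  by apply: (near_flip (K := set0) kp ab _ nc); rewrite ?flip0 // => p q; rewrite inE.
have kp1 : kcol del_rel psi1.
  by elim: H {cl IH nd} => [|d1 a1 b1 C ab1 cl1 _ kd1] //; apply: flip_kcol.
have [c1 nc1] := near_exists kp1.
by apply: (keq_trans (IH c1 nc nc1)); apply: near_flip nc1 nd.
Qed.

Lemma keq_from_del :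
  (exists psi, kcol del_rel psi) /\
    (forall psi psi', kcol del_rel psi -> kcol del_rel psi' -> keq psi psi') ->
  (exists c, kcol e c) /\ (forall c d, kcol e c -> kcol e d -> keq c d).
Proof.
case=> [[psi kp] IH]; split=> [|c d kc kd].
  by have [c [kc _]] := near_exists kp; exists c.
have nearc c' : kcol e c' -> near (del c') c' by move=> kc'; split; auto.
apply: near_keq (nearc _ kc) (nearc _ kd); first exact: del_kcol.
by apply: IH; apply: del_kcol.
Qed.
End Deletion.

(** Induction on the number of non-isolated vertices, with [D] and the colours fixed although
    degrees may drop. Existence is carried along because without a colouring [kappa_E] would be
    zero. *)
Theorem kcol_keq (V T : finType) (D : nat) (e : rel V) :
  symmetric e -> irreflexive e -> (forall p, #|[set q | e p q]| <= D) ->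
  D <= 4 -> D.+2 <= #|T| ->
  (exists c : pcol V T, kcol e c) /\
  (forall c d : pcol V T, kcol e c -> kcol e d -> keq c d).
Proof.
move=> + + + D4 TD.
have [n] := ubnP #|[set p | [exists q, e p q]]|.
elim: n e => // n IHn e lt_n sym irr deg.
have [/existsP[v /existsP[w vw]]|none] := boolP [exists p, [exists q, e p q]].
  apply: (keq_from_del (v := v) sym irr deg D4 TD); apply: IHn.
  - apply: leq_trans (_ : _ < #|[set p | [exists q, e p q]]|) _ => //.
    apply: proper_card; apply/properP; split.
      apply/subsetP=> p; rewrite !inE => /existsP[q /and3P[pq _ _]].
      by apply/existsP; exists q.
    exists v; rewrite !inE; first by apply/existsP; exists w.
    by apply/existsP=> -[q]; rewrite /del_rel eqxx andbF.
  - by move=> p q; rewrite /del_rel sym [(p != v) && _]andbC.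
  - by move=> p; rewrite /del_rel irr.
  - move=> p; apply: leq_trans (deg p); apply: subset_leq_card.
    by apply/subsetP=> q; rewrite !inE => /and3P[].
have e0 p q : e p q = false.
  by apply: contraNF none => pq; apply/existsP; exists p; apply/existsP; exists q.
split.
  by exists [ffun=> None]; split=> [p q|p q|p q r t]; rewrite !ffunE ?e0.
move=> c d [_ domc _] [_ domd _]; rewrite (_ : d = c); first exact: keq0.
apply/ffunP=> -[p q]; have := domc p q; have := domd p q; rewrite e0.
by case: (c _); case: (d _).
Qed.

(** * Colourings of edges and of pairs of vertices *)

Section Translation.
Variables (G : sgraph) (k : nat).
Implicit Types (f g : edge G) (c d : colouring G k).

Lemma pair_edge (x y : G) : ([set x; y] \in edges G) = adj x y.
Proof.
apply/imset2P/idP => [[u w _]|xy]; last first.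
  by exists x y; rewrite // !inE.
rewrite !inE /= => uw E.
have xy : x != y.
  apply: contraTneq uw => xy; have : #|[set x; y]| = #|[set u; w]| by rewrite E.
  rewrite xy setUid cards1 cards2; case: (u =P w) => [->|//].
  by rewrite adj_irrefl.
have xE : x \in [set u; w] by rewrite -E !inE eqxx.
have yE : y \in [set u; w] by rewrite -E !inE eqxx orbT.
move: xE yE xy; rewrite !inE => /orP[] /eqP -> /orP[] /eqP ->; rewrite ?eqxx //.
by rewrite adj_sym.
Qed.

Lemma edge_at f x : x \in val f -> exists y, val f = [set x; y].
Proof.
have /imset2P[u w _ _ ->] := valP f; rewrite !inE => /orP[] /eqP ->.
  by exists w.
by exists u; rewrite setUC.
Qed.

Lemma edge_endpoint f : exists x, x \in val f.
Proof. by have /imset2P[u w _ _ ->] := valP f; exists u; rewrite !inE eqxx. Qed.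

Definition pairs (c : {ffun edge G -> 'I_k}) : pcol G 'I_k :=
  [ffun p => omap c (insub [set p.1; p.2])].

Lemma pairsE (c : {ffun edge G -> 'I_k}) f x y :
  val f = [set x; y] -> pairs c (x, y) = Some (c f).
Proof. by move=> E; rewrite ffunE /= -E valK. Qed.

Lemma pairs_edge (c : {ffun edge G -> 'I_k}) x y t : pairs c (x, y) = Some t ->
  exists2 f, val f = [set x; y] & c f = t.
Proof.
by rewrite ffunE /=; case: insubP => //= f _ E [<-]; exists f.
Qed.

Lemma pairs_kcol c : kcol (@adj G) (pairs (val c)).
Proof.
split=> [p q|p q|p q r t].
- by rewrite !ffunE /= setUC.
- by rewrite ffunE /= -pair_edge; case: insubP => [f ->|/negbTE->].
- move=> /pairs_edge[f Ef cf] /pairs_edge[g Eg cg].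
  have fg : f = g.
    apply/eqP; apply: contraT => nfg.
    have /forallP/(_ f)/forallP/(_ g)/implyP := valP c; rewrite cf cg eqxx.
    apply; rewrite /edge_adj nfg; apply/set0Pn; exists p.
    by rewrite in_setI Ef Eg !inE eqxx.
  have pf : adj p q by rewrite -pair_edge -Ef; apply: valP.
  have : q \in val g by rewrite -fg Ef !inE eqxx orbT.
  by rewrite Eg !inE => /orP[] /eqP // E; rewrite E adj_irrefl in pf.
Qed.

Lemma pairs_inj c d : pairs (val c) = pairs (val d) -> c = d.
Proof.
move=> E; apply/val_inj/ffunP=> f.
have [x /edge_at[y xy]] := edge_endpoint f.
by apply: Some_inj; rewrite -!(pairsE _ xy) E.
Qed.

(** One component is changed and removed from [F] at a time. Edges of other colours may lie in [F],
    since the transposition fixes them. *)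
Lemma flip_edges c a b (F : {set edge G}) : a != b ->
  (forall f g, f \in F -> bicoloured_adj (val c) a b f g -> g \in F) ->
  exists2 d, kempe_equiv c d &
    forall g, val d g = if g \in F then tperm a b (val c g) else val c g.
Proof.
move=> ab; have [n] := ubnP #|[set f in F | val c f \in [set a; b]]|.
elim: n c F => // n IHn c F lt_n cl.
have [E|/set0Pn[f]] := eqVneq [set f in F | val c f \in [set a; b]] set0.
  exists c; first exact: connect0.
  move=> g; case: ifP => // gF; rewrite tperm_id //.
  by have := in_set0 g; rewrite -E inE gF => /negbT.
rewrite inE => /andP[fF cf].
set R := bicoloured_adj (val c) a b.
have Rsym : connect_sym R.
  apply: sym_connect_sym => g h; rewrite /R /bicoloured_adj edge_adj_sym.
  by congr andb; rewrite andbC.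
have compF g : connect R f g -> g \in F.
  case/connectP=> s; elim: s f fF {cf} => [|h s IHs] f' fF /=; first by move=> _ ->.
  by case/andP=> fh; apply: IHs; apply: cl fh.
have pc1 := kempe_change_proper cf (valP c).
pose c1 : colouring G k := Sub _ pc1.
have c1E g : val c1 g = if connect R f g then tperm a b (val c g) else val c g.
  by rewrite SubK ffunE.
have c1in g : (val c1 g \in [set a; b]) = (val c g \in [set a; b]).
  by rewrite SubK kempe_change_in.
have [||d eq_d dE] := IHn c1 [set g in F | ~~ connect R f g].
- apply: leq_trans (_ : _ < #|[set f in F | val c f \in [set a; b]]|) _ => //.
  apply: proper_card; apply/properP; split.
    by apply/subsetP=> g; rewrite !inE -!in_set2 c1in => /andP[/andP[-> _] ->].
  by exists f; rewrite !inE ?fF ?connect0 // -in_set2.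
- move=> g h; rewrite !inE => /andP[gF ng]; rewrite /bicoloured_adj !c1in => gh.
  rewrite (cl g h) //=; apply: contra ng => fh; apply: connect_trans fh _.
  by rewrite Rsym; apply: connect1.
exists d.
  apply: connect_trans eq_d; apply: connect1; apply/orP; left.
  apply/existsP; exists a; apply/existsP; exists b; apply/existsP; exists f.
  by rewrite ab cf SubK eqxx.
move=> g; rewrite dE inE c1E; have [/compF->|_] := boolP (connect R f g).
  by rewrite andbF.
by rewrite andbT.
Qed.

Lemma flip_pairs c a b (C : {set G}) : a != b -> ab_closed (pairs (val c)) a b C ->
  exists2 d, kempe_equiv c d & pairs (val d) = flip (pairs (val c)) a b C.
Proof.
move=> ab cl; pose F := [set f : edge G | [exists x in C, x \in val f]].
have kc := pairs_kcol c.
have C_edge f x y : val f = [set x; y] -> val c f \in [set a; b] -> (x \in C) = (y \in C).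
  move=> Ef cf; apply: (ab_closed_eq kc cl); rewrite (pairsE _ Ef).
  by move: cf; rewrite !inE.
have [f g|d eq_d dE] := @flip_edges c a b F ab.
  rewrite !inE => /exists_inP[x xC xf] /and3P[/andP[_ /set0Pn[z +]] cf _].
  rewrite in_setI => /andP[zf zg]; apply/exists_inP; exists z => //.
  have [y Ef] := edge_at xf; move: zf; rewrite Ef !inE => /orP[] /eqP -> //.
  by rewrite -(C_edge f x y).
exists d => //; apply/ffunP=> -[x y]; rewrite [RHS]ffunE /=.
case Exy: (pairs (val c) (x, y)) => [t|]; last first.
  rewrite if_same; case E: (pairs _ _) => [t|] //.
  by have [f Ef _] := pairs_edge E; rewrite (pairsE _ Ef) in Exy.
have [f Ef cf] := pairs_edge Exy.
rewrite (pairsE _ Ef) dE /= cf.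
have [xC|xC] := boolP (x \in C).
  rewrite (_ : f \in F) // inE; apply/exists_inP; exists x => //.
  by rewrite Ef !inE eqxx.
case: ifP => //; rewrite inE => /exists_inP[z zC]; rewrite Ef !inE.
case/orP=> /eqP Ez; first by rewrite -Ez zC in xC.
rewrite tperm_id // -cf; apply: contra xC => cab.
by rewrite (C_edge f x y) // -Ez.
Qed.

Lemma keq_kempe_equiv c d : keq (pairs (val c)) (pairs (val d)) -> kempe_equiv c d.
Proof.
suff H m : keq (pairs (val c)) m -> exists2 d, kempe_equiv c d & pairs (val d) = m.
  by case/H=> d' cd /pairs_inj <-.
elim=> [|m' a b C ab cl _ [d1 cd1 E1]]; first by exists c => //; apply: connect0.
rewrite -E1 in cl *; have [d2 cd2 E2] := flip_pairs ab cl.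
by exists d2 => //; apply: connect_trans cd1 cd2.
Qed.

Lemma kcol_colouring (t0 : 'I_k) (m : pcol G 'I_k) :
  kcol (@adj G) m -> exists c : colouring G k, pairs (val c) = m.
Proof.
move=> [sym dom inj].
have ends_ex f : exists p : G * G, val f == [set p.1; p.2].
  by have [x /edge_at[y ->]] := edge_endpoint f; exists (x, y).
(* An arbitrary order of the endpoints, immaterial because [m] is symmetric. The default [t0] is
   never taken, as [m] is defined on edges. *)
pose ends f := xchoose (ends_ex f).
pose c := [ffun f => odflt t0 (m (ends f))].
have cE f x y : val f = [set x; y] -> m (x, y) = Some (c f).
  move=> Ef; have xy : adj x y by rewrite -pair_edge -Ef; apply: valP.
  have nxy : x != y by apply: contraTneq xy => ->; rewrite adj_irrefl.
  have : isSome (m (x, y)) by rewrite dom.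
  suff : m (ends f) = m (x, y) by rewrite /c ffunE => ->; case: (m _).
  have := xchooseP (ends_ex f); rewrite -/(ends f); case: (ends f) => u w /eqP /=.
  rewrite Ef => E.
  have xE : x \in [set u; w] by rewrite -E !inE eqxx.
  have yE : y \in [set u; w] by rewrite -E !inE eqxx orbT.
  move: xE yE nxy; rewrite !inE => /orP[] /eqP -> /orP[] /eqP ->; rewrite ?eqxx //.
suff pc : proper_colouring c.
  exists (Sub c pc); rewrite SubK; apply/ffunP=> -[x y].
  case Exy: (pairs c (x, y)) => [t|].
    by have [f Ef <-] := pairs_edge Exy; rewrite (cE _ _ _ Ef).
  case Mxy: (m (x, y)) => [t|] //; have := dom x y.
  rewrite Mxy => /esym; rewrite -pair_edge => xyE.
  by rewrite (@pairsE c (Sub [set x; y] xyE)) in Exy.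
apply/forallP=> f; apply/forallP=> g; apply/implyP=> /andP[fg /set0Pn[x]].
rewrite in_setI => /andP[/edge_at[y Ef] /edge_at[z Eg]].
apply: contra fg => /eqP E; apply/eqP/val_inj; rewrite Ef Eg.
by congr [set _; _]; apply: (inj x y z (c f)); [apply: cE | rewrite E; apply: cE].
Qed.
End Translation.

Theorem theorem2 (G : sgraph) (hG : max_degree G <= 4) :
  kappa_E G (max_degree G).+2 = 1 /\
  (forall c d : colouring G (max_degree G).+2, kempe_equiv c d).
Proof.
have deg (p : G) : #|[set q | adj p q]| <= max_degree G.
  exact: (leq_bigmax (F := @degree G) p).
have [|[m km] all_keq] := @kcol_keq G 'I_(max_degree G).+2 _ _ (@adj_sym G) (@adj_irrefl G) deg hG.
  by rewrite card_ord.
have all_equiv (c d : colouring G (max_degree G).+2) : kempe_equiv c d.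
  by apply/keq_kempe_equiv/all_keq; apply: pairs_kcol.
(* The colouring [c] ensures that the partition has one block rather than none. *)
split=> //; have [c _] := kcol_colouring ord0 km.
rewrite /kappa_E (_ : equivalence_partition _ _ = [set [set: colouring G _]]) ?cards1 //.
apply/setP=> B; rewrite !inE; apply/imsetP/eqP => [[d _ ->]|->].
  by apply/setP=> d'; rewrite !inE all_equiv.
by exists c => //; apply/setP=> d'; rewrite !inE all_equiv.
Qed.
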